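(* Let $\Sigma$ be a Lefschetz fan of dimension $d$, and $\ell_2,\ell_3,\ldots,\ell_d$ elements in the closure of $\mathscr K(\Sigma)$. Then for any $\ell_1\in A^1(\Sigma)$, \[ \deg(\ell_1\ell_2\cdots \ell_d)^2\geq \deg(\ell_1\ell_1\ell_3\cdots \ell_d)\cdot \deg(\ell_2\ell_2\ell_3\cdots \ell_d). \]
   Context: $\Sigma$ is a rational simplicial fan in $\mathrm N=\mathbb R\otimes\mathrm N_{\mathbb Z}$ with Chow ring $A(\Sigma)$ (piecewise polynomials modulo global linear functions). For a cone $\sigma$, $\mathrm{st}_\Sigma(\sigma)$ is the fan in $\mathrm N/\mathrm{span}(\sigma)$ of images of cones containing $\sigma$, with restriction $\iota_\sigma^*$. $\mathscr K(\Sigma)\subseteq A^1(\Sigma)$ is the cone of classes $\ell$ such that for every cone $\sigma$ (including $\{0\}$), $\iota_\sigma^*\ell$ has a representative positive on the nonzero support of $\mathrm{st}_\Sigma(\sigma)$. Lefschetz: $d$-dimensional Minkowski weights spanned by a positive weight, giving $\deg:A^d(\Sigma)\cong\mathbb R$; Poincaré duality; for $k\le d/2$ and $\ell\in\mathscr K(\Sigma)$, $\ell^{d-2k}:A^k\to A^{d-k}$ is an isomorphism and $(-1)^k\deg(\ell^{d-2k}\eta_1\eta_2)$ is positive definite on $\ker\ell^{d-2k+1}\subseteq A^k$; and stars of nonzero cones are Lefschetz. *)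

(* Defs.v *)
From HB Require Import structures.
From mathcomp Require Import all_boot all_order all_algebra finmap.
From mathcomp Require Import all_classical all_reals all_analysis.
(* Without its notations, which clash with those of mathcomp-analysis. *)
From mathcomp Require Import -(notations) mpoly.

Set Implicit Arguments.
Unset Strict Implicit.
Unset Printing Implicit Defensive.

Import Order.TTheory GRing.Theory Num.Theory.
Import numFieldNormedType.Exports.

Local Open Scope classical_set_scope.
Local Open Scope ring_scope.

(* A simplicial fan is encoded by its lattice N_Z, by one generator for each
   ray, and by the collection of the sets of rays that span its cones. The
   dimension of a cone is the number of its rays, and its faces are the subsets.
   The lattice is any lattice in R^n, not necessarily of full rank; N is its
   real span. Nothing below depends on the choice of a space containing N: the
   linear functions on N are the restrictions of those on R^n. Indices i such
   that [set i] is not a cone are not rays of the fan; this happens in stars,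
   which are indexed by the rays of the original fan. *)
Record fan_data (R : realType) (n m : nat) := FanData {
  lattice : set 'rV[R]_n;
  ray : 'I_m -> 'rV[R]_n;
  cones : {set {set 'I_m}}
}.

Section LefschetzFans.
Variables (R : realType) (n m : nat).
Local Notation N := 'rV[R]_n.
Local Notation fan := (fan_data R n m).
Implicit Types (F : fan) (s t : {set 'I_m}) (L : set N).

Definition is_lattice L : Prop :=
  exists (r : nat) (b : 'M[R]_(r, n)),
    row_free b /\ L = [set x | exists z : 'rV[int]_r, x = map_mx intr z *m b].

(* The lattice points of the half-line spanned by v are the natural multiples
   of v. *)
Definition primitive L (v : N) : Prop :=
  v != 0 /\ forall c : R, 0 <= c -> (L (c *: v) <-> exists k : nat, c = k%:R).

Definition cone F s : set N :=
  [set x | exists c : 'I_m -> R,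
     (forall i, i \in s -> 0 <= c i) /\ x = \sum_(i in s) c i *: ray F i].

Definition fan_support F : set N :=
  [set x | exists2 s, s \in cones F & cone F s x].

Definition cone_span F s : 'M[R]_(m, n) :=
  \matrix_(i < m) (if i \in s then ray F i else 0).

Definition rational_simplicial_fan F : Prop :=
  [/\ is_lattice (lattice F),
      (forall i, [set i]%SET \in cones F -> primitive (lattice F) (ray F i)),
      (forall s, s \in cones F -> \rank (cone_span F s) = #|s|),
      finset.set0 \in cones F /\
        (forall s t, s \in cones F -> t \subset s -> t \in cones F)
    & (forall s t, s \in cones F -> t \in cones F ->
         cone F s `&` cone F t = cone F (s :&: t))].

Definition fan_dim F : nat := \max_(s in cones F) #|s|.

(* The quotient N / span(s), realised as the image of the endomorphism
   cokermx (cone_span F s) of R^n, whose kernel is span(s) (see submxE). *)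
Definition quotient_map F s (x : N) : N := x *m cokermx (cone_span F s).

(* The generator of the ray spanned by v that is primitive in L. *)
Definition primitive_generator L (v : N) : N :=
  xget v [set u | primitive L u /\ exists2 c : R, 0 < c & u = c *: v].

(* The image of a cone t containing s is indexed by t :\: s. *)
Definition star F s : fan :=
  let L := quotient_map F s @` lattice F in
  FanData L
    (fun i => primitive_generator L (quotient_map F s (ray F i)))
    [set t : {set 'I_m} | [disjoint t & s] && (t :|: s \in cones F)]%SET.

(* The subfan of F, in N, of the faces of the cones that contain s. *)
Definition closed_star F s : fan :=
  FanData (lattice F) (ray F) [set t : {set 'I_m} | t :|: s \in cones F]%SET.

(* Piecewise polynomials of degree k. Only the values on the support matter. *)
Definition piecewise_poly F (k : nat) (f : N -> R) : Prop :=
  forall s, s \in cones F ->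
    exists2 p : mpoly n R, p \is ishomog1 k (@mdeg n) &
      forall x, cone F s x -> f x = meval (x 0) p.

(* The degree k part of the ideal of the ring of piecewise polynomials that is
   generated by the global linear functions, i.e. by the coordinates. *)
Definition linear_ideal F (k : nat) (f : N -> R) : Prop :=
  match k with
  | 0 => forall x, fan_support F x -> f x = 0
  | k'.+1 => exists2 h : 'I_n -> N -> R,
      (forall i, piecewise_poly F k' (h i)) &
      forall x, fan_support F x -> f x = \sum_(i < n) x 0 i * h i x
  end.

(* A^k(F) is the space of the f such that piecewise_poly F k f, up to this
   relation; products are pointwise products of representatives. *)
Definition chow_eq F (k : nat) (f g : N -> R) : Prop :=
  linear_ideal F k (fun x => f x - g x).

(* The class of g in A^k(star F s) is the restriction of the class of f in
   A^k(F): the composition with the quotient map induces an isomorphism from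
   A(star F s) to A(closed_star F s), and iota_s^* is the restriction of
   functions to the closed star followed by the inverse of this isomorphism.
   For k = 1 this says that f minus some linear function descends to g. *)
Definition star_restriction F s (k : nat) (f g : N -> R) : Prop :=
  chow_eq (closed_star F s) k f (fun x => g (quotient_map F s x)).

(* f represents a class in K(F). *)
Definition in_K F (f : N -> R) : Prop :=
  piecewise_poly F 1 f /\
  forall s, s \in cones F ->
    exists g : N -> R,
      [/\ piecewise_poly (star F s) 1 g, star_restriction F s 1 f g &
          forall y, fan_support (star F s) y -> y != 0 -> 0 < g y].

(* Piecewise linear functions are identified with their values at the rays. *)
Definition ray_values F (f : N -> R) : 'rV[R]_m :=
  \row_(i < m) (if [set i]%SET \in cones F then f (ray F i) else 0).

(* f represents a class in the closure of K(F) in A^1(F). As A^1(F) is the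
   quotient of the space of piecewise linear functions by a subspace, under
   which in_K is invariant, the closure can be taken before the quotient. *)
Definition in_closure_K F (f : N -> R) : Prop :=
  piecewise_poly F 1 f /\ closure (ray_values F @` in_K F) (ray_values F f).

(* For i not in t, ray (star F t) i is the primitive generator of the image of
   the cone i |: t in N / span(t). *)
Definition minkowski_weight F (k : nat) (w : {set 'I_m} -> R) : Prop :=
  forall t, t \in cones F -> #|t|.+1 = k ->
    \sum_(i | (i \notin t) && (i |: t \in cones F))
      w (i |: t) *: ray (star F t) i = 0.

Definition fundamental_weight F (w : {set 'I_m} -> R) : Prop :=
  let d := fan_dim F in
  [/\ minkowski_weight F d w,
      (forall s, s \in cones F -> #|s| = d -> 0 < w s)
    & (forall w', minkowski_weight F d w' ->
         exists c : R, forall s, s \in cones F -> #|s| = d -> w' s = c * w s)].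

(* The multiplicity of a cone, i.e. the index of the group generated by its rays
   in the group of lattice points of its span: the lattice points of the
   half-open parallelepiped form a system of representatives of the quotient. *)
Definition multiplicity F s : nat :=
  #|` fset_set [set x : N | lattice F x /\
        exists c : 'I_m -> R, (forall i, i \in s -> 0 <= c i < 1) /\
          x = \sum_(i in s) c i *: ray F i] |.

Definition courant_function F (i : 'I_m) (f : N -> R) : Prop :=
  piecewise_poly F 1 f /\
  forall j, [set j]%SET \in cones F -> f (ray F j) = (j == i)%:R.

(* deg is the linear isomorphism A^d(F) -> R corresponding to w. With x_i the
   Courant functions, deg (\prod_(i in s) x_i) is w s / multiplicity F s, and
   it is w s when the fan is unimodular. *)
Definition degree_map F (w : {set 'I_m} -> R) (deg : (N -> R) -> R) : Prop :=
  let d := fan_dim F in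
  [/\ (forall (a : R) f g, piecewise_poly F d f -> piecewise_poly F d g ->
         deg (fun x => a * f x + g x) = a * deg f + deg g),
      (forall f, piecewise_poly F d f ->
         (deg f = 0 <-> chow_eq F d f (fun=> 0))),
      (forall a : R, exists2 f, piecewise_poly F d f & deg f = a)
    & (forall s (x : 'I_m -> N -> R), s \in cones F -> #|s| = d ->
         (forall i, i \in s -> courant_function F i (x i)) ->
         deg (fun v => \prod_(i in s) x i v) * (multiplicity F s)%:R = w s)].

Definition poincare_duality F (deg : (N -> R) -> R) : Prop :=
  forall k, (k <= fan_dim F)%N -> forall f, piecewise_poly F k f ->
    (forall g, piecewise_poly F (fan_dim F - k) g ->
       deg (fun x => f x * g x) = 0) ->
    chow_eq F k f (fun=> 0).

Definition hard_lefschetz F : Prop :=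
  let d := fan_dim F in
  forall k l, (k.*2 <= d)%N -> in_K F l ->
    (forall f, piecewise_poly F k f ->
       chow_eq F (d - k) (fun x => l x ^+ (d - k.*2) * f x) (fun=> 0) ->
       chow_eq F k f (fun=> 0)) /\
    (forall g, piecewise_poly F (d - k) g ->
       exists2 f, piecewise_poly F k f &
         chow_eq F (d - k) (fun x => l x ^+ (d - k.*2) * f x) g).

Definition hodge_riemann F (deg : (N -> R) -> R) : Prop :=
  let d := fan_dim F in
  forall k l, (k.*2 <= d)%N -> in_K F l ->
    forall f, piecewise_poly F k f ->
      chow_eq F (d - k).+1 (fun x => l x ^+ (d - k.*2).+1 * f x) (fun=> 0) ->
      ~ chow_eq F k f (fun=> 0) ->
      0 < (-1) ^+ k * deg (fun x => l x ^+ (d - k.*2) * f x * f x).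

Inductive lefschetz F : Prop :=
  Lefschetz (w : {set 'I_m} -> R) (deg : (N -> R) -> R) of
    fundamental_weight F w & degree_map F w deg & poincare_duality F deg &
    hard_lefschetz F & hodge_riemann F deg &
    (forall s, s \in cones F -> s != finset.set0 -> lefschetz (star F s)).

End LefschetzFans.

(* Main.v *)
Require Import Defs.
From HB Require Import structures.
From mathcomp Require Import all_boot all_order all_algebra.
From mathcomp Require Import all_classical all_reals all_analysis.
From mathcomp Require Import -(notations) mpoly.
From mathcomp Require Import ring lra.

Set Implicit Arguments.
Unset Strict Implicit.
Unset Printing Implicit Defensive.

Import Order.TTheory GRing.Theory Num.Theory.
Import numFieldNormedType.Exports.

Local Open Scope ring_scope.

(* It suffices to treat l_2, ..., l_d in K(F), since both sides are polynomial in
   the ray values of each l_i. Then the theorem says that the form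
   Q(f, g) = deg (f g l_3 ... l_d) on A^1(F) has one positive direction, which is
   proved by induction on d. For d = 2 this is the Hodge-Riemann relation in
   degree 1. For d >= 3, write l_3 = \sum_i a_i x_i modulo linear functions, with
   a_i > 0 and x_i the Courant functions. As deg (x_i -) is a positive multiple of
   the degree of the star of the ray i (or zero, if the star has dimension less
   than d - 1), the theorem for the stars gives
     deg (x_i f f l_4 ... l_d) <= Q(x_i, f)^2 / Q(x_i, l_3),
   and summing these with weights a_i gives
     Q(f, f) <= \sum_i a_i Q(x_i, f)^2 / Q(x_i, l_3).
   Let A be the operator associated with Q for the inner product with weights
   Q(x_i, l_3) / a_i. The last inequality is A <= A^2, and A a = a. The matrix
   Q(x_i, x_j) is nonnegative off the diagonal, and irreducible because the
   fundamental weight is unique, so 1 is the largest eigenvalue of A and it is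
   simple; hence A <= 0 on the orthogonal complement of a. *)

Lemma factor_mx (K : fieldType) (p q r : nat) (A : 'M[K]_(p, q)) (B : 'M[K]_(p, r)) :
  (forall x : 'rV_p, x *m A = 0 -> x *m B = 0) -> exists P, B = A *m P.
Proof.
move=> kerAB; have : (B^T <= A^T)%MS.
  rewrite submxE; apply/eqP/trmx_inj; rewrite trmx_mul trmxK trmx0.
  apply/row_matrixP => i; rewrite row_mul row0; apply: kerAB.
  rewrite -row_mul; apply/trmx_inj; rewrite -[A in _ *m A]trmxK -trmx_mul.
  by rewrite mulmx_coker trmx0 row0.
move=> /submxP[P eB]; exists P^T.
by apply: trmx_inj; rewrite trmx_mul trmxK.
Qed.

(** * Coordinates and piecewise polynomials *)

Section Fan.
Context (R : realType) (n m : nat).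
Local Notation N := 'rV[R]_n.
Local Notation fan := (fan_data R n m).
Implicit Types (F G : fan) (s t : {set 'I_m}) (c : 'rV[R]_m) (f g h : N -> R).

Definition ray_mx F : 'M[R]_(m, n) := \matrix_i ray F i.
Definition vsupp c : {set 'I_m} := [set i | c 0 i != 0]%SET.

Definition cone_coef F c := (forall i, 0 <= c 0 i) /\ vsupp c \in cones F.

(* Uniqueness of coordinates says at once that the rays of a cone are linearly
   independent and that two cones meet along a common face. *)
Definition simplicial F :=
  [/\ finset.set0 \in cones F,
      (forall s t, s \in cones F -> t \subset s -> t \in cones F)
    & forall c c', cone_coef F c -> cone_coef F c' ->
        c *m ray_mx F = c' *m ray_mx F -> c = c'].

Lemma vsuppP c s : reflect (forall i, i \notin s -> c 0 i = 0) (vsupp c \subset s).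
Proof.
apply: (iffP fintype.subsetP) => [sub i iNs|sub i].
  by apply/eqP; apply: contraNT iNs => ci; apply: sub; rewrite inE.
by rewrite inE; apply: contra_neqT => /sub.
Qed.

Lemma mul_ray_mx F c : c *m ray_mx F = \sum_i c 0 i *: ray F i.
Proof. by rewrite mulmx_sum_row; apply: eq_bigr => i _; rewrite rowK. Qed.

Lemma coneP F s v : cone F s v <->
  exists c, [/\ forall i, 0 <= c 0 i, vsupp c \subset s & v = c *m ray_mx F].
Proof.
split=> [[c [c0 ->]]|[c [c0 /vsuppP sc ->]]].
  exists (\row_i if i \in s then c i else 0); split.
  - by move=> i; rewrite mxE; case: ifP => // /c0.
  - by apply/vsuppP => i /negbTE iNs; rewrite mxE iNs.
  - rewrite mul_ray_mx [LHS]big_mkcond; apply: eq_bigr => i _.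
    by rewrite mxE; case: ifP => //; rewrite scale0r.
exists (c 0); split=> //; rewrite mul_ray_mx [RHS]big_mkcond; apply: eq_bigr => i _.
by case: ifPn => // /sc ->; rewrite scale0r.
Qed.

Lemma cone0 F s : cone F s 0.
Proof.
apply/coneP; exists 0; split; [by move=> i; rewrite mxE| |by rewrite mul0mx].
by apply/vsuppP => i _; rewrite mxE.
Qed.

Section Poly.

Lemma homog1_meval (p : mpoly n R) : p \is ishomog1 1%N (@mdeg n) ->
  exists u : 'cV[R]_n, forall v : N, meval (v 0) p = (v *m u) 0 0.
Proof.
move=> /dhomogP hp.
exists (\sum_(k <- msupp p) mcoeff k p *: \col_i (k i)%:R) => v.
rewrite mevalE mulmx_sumr summxE big_seq [RHS]big_seq; apply: eq_bigr => k /hp /eqP.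
move=> /mdeg1P[i /eqP ->].
rewrite -scalemxAr !mxE; congr (_ * _).
under [RHS]eq_bigr do rewrite mxE mnm1E.
rewrite (bigD1 i) //= mnm1E eqxx expr1 big1 => [|j ji]; last first.
  by rewrite mnm1E eq_sym (negbTE ji) expr0.
rewrite (bigD1 i) //= eqxx big1 ?addr0 // => j.
by rewrite eq_sym => /negbTE ->; rewrite mulr0.
Qed.

Lemma homog0_meval (p : mpoly n R) : p \is ishomog1 0%N (@mdeg n) ->
  forall v w : N, meval (v 0) p = meval (w 0) p.
Proof.
move=> /dhomogP hp v w; rewrite !mevalE big_seq [RHS]big_seq; apply: eq_bigr => k /hp /eqP.
by rewrite mdeg_eq0 => /eqP ->; congr (_ * _); apply: eq_bigr => i _; rewrite mnm0E !expr0.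
Qed.

Lemma linear_mpoly (u : 'cV[R]_n) : exists2 p : mpoly n R,
  p \is ishomog1 1%N (@mdeg n) & forall v : N, meval (v 0) p = (v *m u) 0 0.
Proof.
exists (\sum_i u i 0 *: mpolyX R (mnm1 i)).
  by apply: rpred_sum => i _; rewrite rpredZ // dhomogX; apply/eqP; apply: mdeg1.
move=> v; rewrite raddf_sum mxE; apply: eq_bigr => i _.
by rewrite /= mevalZ mevalXU mulrC.
Qed.

Lemma comp_linear_mpoly k (p : mpoly n R) (A : 'M[R]_n) :
  p \is ishomog1 k (@mdeg n) -> exists2 p' : mpoly n R,
  p' \is ishomog1 k (@mdeg n) & forall v : N, meval (v 0) p' = meval ((v *m A) 0) p.
Proof.
have /fin_all_exists2[q hq eq] j := linear_mpoly (col j A).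
move=> /dhomogP hp; exists (comp_mpoly [tuple q j | j < n] p).
  rewrite comp_mpolyEX big_seq; apply: rpred_sum => k' /hp /(etrans (esym (mdegE k'))) <-.
  rewrite rpredZ // comp_mpolyX; elim: (index_enum _) => [|i r IHr].
    by rewrite !big_nil; exact: dhomog1.
  rewrite !big_cons; apply: dhomogM IHr.
  by rewrite tnth_mktuple; have := dhomogMn (k' i) (hq i); rewrite mul1n.
move=> v; rewrite comp_mpoly_meval; apply: meval_eq => j.
by rewrite tnth_mktuple eq !mxE; apply: eq_bigr => i _; rewrite mxE.
Qed.

End Poly.

Local Notation pp := piecewise_poly.

Lemma pp_ext F k f g :
  pp F k f -> (forall v, fan_support F v -> f v = g v) -> pp F k g.
Proof.
move=> ppf fg s sF; have [p hp pE] := ppf s sF; exists p => // v sv.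
by rewrite -fg ?pE //; exists s.
Qed.

Lemma ppD F k f g : pp F k f -> pp F k g -> pp F k (fun v => f v + g v).
Proof.
move=> ppf ppg s sF; have [p hp pE] := ppf s sF; have [q hq qE] := ppg s sF.
by exists (p + q) => [|v sv]; [rewrite rpredD|rewrite mevalD pE // qE].
Qed.

Lemma ppZ F k a f : pp F k f -> pp F k (fun v => a * f v).
Proof.
move=> ppf s sF; have [p hp pE] := ppf s sF.
by exists (a *: p) => [|v sv]; [rewrite rpredZ|rewrite mevalZ pE].
Qed.

Lemma ppM F k l f g : pp F k f -> pp F l g -> pp F (k + l) (fun v => f v * g v).
Proof.
move=> ppf ppg s sF; have [p hp pE] := ppf s sF; have [q hq qE] := ppg s sF.
by exists (p * q) => [|v sv]; [rewrite dhomogM|rewrite mevalM pE // qE].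
Qed.

Lemma ppSM F k f g : pp F 1 f -> pp F k g -> pp F k.+1 (fun v => f v * g v).
Proof. exact: (@ppM F 1 k). Qed.

Lemma pp0 F k : pp F k (fun=> 0).
Proof. by move=> s _; exists 0 => [|v _]; [exact: dhomog0|rewrite meval0]. Qed.

Lemma pp1 F : pp F 0 (fun=> 1).
Proof. by move=> s _; exists 1 => [|v _]; [exact: dhomog1|rewrite meval1]. Qed.

Lemma ppB F k f g : pp F k f -> pp F k g -> pp F k (fun v => f v - g v).
Proof.
move=> ppf ppg; apply: pp_ext (ppD ppf (ppZ (-1) ppg)) _ => v _.
by rewrite mulN1r.
Qed.

Lemma pp_sum F k (I : Type) (r : seq I) (P : pred I) (f : I -> N -> R) :
  (forall i, P i -> pp F k (f i)) -> pp F k (fun v => \sum_(i <- r | P i) f i v).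
Proof.
move=> ppf; elim: r => [|i r IHr].
  by apply: pp_ext (@pp0 F k) _ => v _; rewrite big_nil.
case Pi: (P i); last by apply: pp_ext IHr _ => v _; rewrite big_cons Pi.
by apply: pp_ext (ppD (ppf i Pi) IHr) _ => v _; rewrite big_cons Pi.
Qed.

Lemma pp_lin F (u : 'cV[R]_n) : pp F 1 (fun v => (v *m u) 0 0).
Proof. by move=> s sF; have [p hp pE] := linear_mpoly u; exists p. Qed.

Lemma pp_bigprod F (I : Type) (r : seq I) (f : I -> N -> R) :
  (forall i, pp F 1 (f i)) -> pp F (size r) (fun v => \prod_(i <- r) f i v).
Proof.
move=> ppf; elim: r => [|i r IHr] /=.
  by apply: pp_ext (@pp1 F) _ => v _; rewrite big_nil.
by apply: pp_ext (ppSM (ppf i) IHr) _ => v _; rewrite big_cons.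
Qed.

Lemma pp_prodset F s (f : 'I_m -> N -> R) :
  (forall i, pp F 1 (f i)) -> pp F #|s| (fun v => \prod_(i in s) f i v).
Proof.
move=> /(pp_bigprod (enum s)); rewrite -cardE => /pp_ext; apply=> v _.
by rewrite big_enum.
Qed.

Lemma pp_prod F (ls : seq (N -> R)) :
  List.Forall (pp F 1) ls -> pp F (size ls) (fun v => \prod_(l <- ls) l v).
Proof.
elim: ls => [|l ls IHls] /= ppls.
  by apply: pp_ext (@pp1 F) _ => v _; rewrite big_nil.
have [ppl /IHls {}IHls] := (List.Forall_inv ppls, List.Forall_inv_tail ppls).
by apply: pp_ext (ppSM ppl IHls) _ => v _; rewrite big_cons.
Qed.

Lemma pp1_cone F s f : pp F 1 f -> s \in cones F ->
  exists u : 'cV[R]_n, forall v, cone F s v -> f v = (v *m u) 0 0.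
Proof.
move=> ppf sF; have [p /homog1_meval[u uE] pE] := ppf s sF.
by exists u => v /pE ->.
Qed.

Lemma pp1_at0 F f : cones F != finset.set0 -> pp F 1 f -> f 0 = 0.
Proof.
move=> /set0Pn[s sF] ppf; have [u uE] := pp1_cone ppf sF.
by rewrite uE ?mul0mx ?mxE //; apply: cone0.
Qed.

Lemma pp_comp F G k (A : 'M[R]_n) g :
  (forall s, s \in cones F -> exists2 t, t \in cones G &
     forall v, cone F s v -> cone G t (v *m A)) ->
  pp G k g -> pp F k (fun v => g (v *m A)).
Proof.
move=> FG ppg s /FG[t tG st]; have [p hp pE] := ppg t tG.
have [p' hp' p'E] := comp_linear_mpoly A hp.
by exists p' => // v sv; rewrite p'E pE //; apply: st.
Qed.

Lemma linear_ideal1 F f : linear_ideal F 1 f <->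
  exists u : 'cV[R]_n, forall v, fan_support F v -> f v = (v *m u) 0 0.
Proof.
split=> [[h hh fE]|[u uE]].
  exists (\col_i h i 0) => v vF; rewrite fE // mxE; apply: eq_bigr => i _.
  rewrite mxE; congr (_ * _); have [s sF sv] := vF.
  have [p /homog0_meval hp pE] := hh i s sF.
  by rewrite !pE //; apply: cone0.
exists (fun i _ => u i 0) => [i|v vF]; last by rewrite uE // mxE.
by apply: pp_ext (ppZ (u i 0) (@pp1 F)) _ => v _; rewrite mulr1.
Qed.

Section Simplicial.
Variable (F : fan).
Hypothesis simpF : simplicial F.

Lemma cone_coefP s v : s \in cones F -> cone F s v ->
  exists c, [/\ cone_coef F c, vsupp c \subset s & v = c *m ray_mx F].
Proof.
have [_ faceF _] := simpF.
by move=> sF /coneP[c [c0 cs ->]]; exists c; split=> //; split=> //; apply: faceF cs.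
Qed.

Lemma fan_supportP v : fan_support F v <->
  exists2 c, cone_coef F c & v = c *m ray_mx F.
Proof.
split=> [[s sF /(cone_coefP sF)[c [? _ ?]]]|[c [c0 cF] ->]]; first by exists c.
by exists (vsupp c) => //; apply/coneP; exists c.
Qed.

Definition cone_coord (v : N) : 'rV[R]_m :=
  xget 0 (fun c => cone_coef F c /\ v = c *m ray_mx F).

Lemma coordK c : cone_coef F c -> cone_coord (c *m ray_mx F) = c.
Proof.
have [_ _ injF] := simpF => cF; rewrite /cone_coord.
by case: xgetP => [c' _ [c'F]|/(_ c)[]//] /esym/injF; apply.
Qed.

Lemma coordP v : fan_support F v ->
  cone_coef F (cone_coord v) /\ v = cone_coord v *m ray_mx F.
Proof. by move=> /fan_supportP[c cF ->]; rewrite coordK. Qed.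

Lemma coord_ge0 v i : fan_support F v -> 0 <= cone_coord v 0 i.
Proof. by move=> /coordP[[]]. Qed.

Lemma coord_supp s v : s \in cones F -> cone F s v -> vsupp (cone_coord v) \subset s.
Proof. by move=> sF /(cone_coefP sF)[c [cF cs ->]]; rewrite coordK. Qed.

Lemma cone_free s c : s \in cones F -> vsupp c \subset s ->
  c *m ray_mx F = 0 -> c = 0.
Proof.
have [_ faceF injF] := simpF => sF /vsuppP cs c0.
pose pos (c : 'rV[R]_m) := \row_i Num.max (c 0 i) 0.
have posF (e : R) : cone_coef F (pos (e *: c)).
  split=> [i|]; first by rewrite mxE le_max lexx orbT.
  by apply: (faceF _ _ sF); apply/vsuppP => i /cs ci; rewrite !mxE ci mulr0 maxxx.
have cE : c = pos (1 *: c) - pos (-1 *: c).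
  apply/rowP => i; rewrite !mxE mul1r mulN1r.
  case: (lerP 0 (c 0 i)) => ci; first by rewrite max_r ?subr0 // oppr_le0.
  by rewrite max_l ?oppr_ge0 ?ltW // sub0r opprK.
have /injF : pos (1 *: c) *m ray_mx F = pos (-1 *: c) *m ray_mx F.
  by apply/eqP; rewrite -subr_eq0 -mulmxBl -cE c0.
by move=> /(_ (posF _) (posF _)) ec; rewrite cE ec subrr.
Qed.

Lemma coord_mx s : s \in cones F -> exists P : 'M[R]_(n, m),
  forall v, cone F s v -> cone_coord v = v *m P.
Proof.
move=> sF; pose D : 'M[R]_m := diag_mx (\row_i (i \in s)%:R).
have [x|P eP] := @factor_mx _ _ _ _ (D *m ray_mx F) D.
  rewrite mulmxA; apply: (cone_free sF); apply/vsuppP => i /negbTE iNs.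
  by rewrite mul_mx_diag !mxE iNs mulr0.
exists P => v /(cone_coefP sF)[c [cF /vsuppP cs ->]]; rewrite (coordK cF).
have cD : c = c *m D.
  apply/rowP => i; rewrite mul_mx_diag !mxE; case: (boolP (i \in s)) => [|/cs ->].
    by rewrite mulr1.
  by rewrite mul0r.
by rewrite {1}cD {1}eP !mulmxA -cD.
Qed.

Lemma pp_coord i : pp F 1 (fun v => cone_coord v 0 i).
Proof.
move=> s sF; have [P eP] := coord_mx sF; have [p hp pE] := linear_mpoly (col i P).
exists p => // v sv; rewrite eP // pE !mxE.
by apply: eq_bigr => j _; rewrite mxE.
Qed.

Lemma ray_cone s i : i \in s -> s \in cones F -> [set i]%SET \in cones F.
Proof. by have [_ faceF _] := simpF => si sF; apply: faceF sF _; rewrite finset.sub1set. Qed.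

Lemma ray_coef i : [set i]%SET \in cones F -> cone_coef F (delta_mx 0 i).
Proof.
move=> iF; split=> [j|]; first by rewrite mxE ler0n.
suff -> : vsupp (delta_mx 0 i) = [set i]%SET by [].
by apply/setP => j; rewrite !inE mxE /= pnatr_eq0 eqb0 negbK.
Qed.

Lemma delta_ray i : delta_mx 0 i *m ray_mx F = ray F i.
Proof. by rewrite -rowE rowK. Qed.

Lemma cone_ray s i : i \in s -> cone F s (ray F i).
Proof.
move=> si; apply/coneP; exists (delta_mx 0 i); split; last by rewrite delta_ray.
  by move=> j; rewrite mxE ler0n.
apply/vsuppP => j; rewrite mxE /=; apply: contraNeq.
by rewrite pnatr_eq0 eqb0 negbK => /eqP ->.
Qed.

Lemma coord_ray i : [set i]%SET \in cones F -> cone_coord (ray F i) = delta_mx 0 i.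
Proof. by move=> iF; rewrite -delta_ray coordK //; apply: ray_coef. Qed.

Lemma ray_neq0 i : [set i]%SET \in cones F -> ray F i != 0.
Proof.
move=> iF; apply/eqP => r0; have := coord_ray iF.
have -> : ray F i = 0 *m ray_mx F by rewrite r0 mul0mx.
rewrite coordK; last first.
  split=> [j|]; first by rewrite mxE.
  have [F0 _ _] := simpF; suff -> : vsupp 0 = finset.set0 by [].
  by apply/setP => j; rewrite !inE mxE eqxx.
by move=> /rowP/(_ i); rewrite !mxE !eqxx => /eqP; rewrite eq_sym oner_eq0.
Qed.

Lemma coord_nray v i : fan_support F v -> [set i]%SET \notin cones F ->
  cone_coord v 0 i = 0.
Proof.
move=> /coordP[[_ vF] _] iF; apply/eqP; apply: contraNT iF => vi.
by apply: ray_cone vF; rewrite inE.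
Qed.

Lemma pp1E f v : pp F 1 f -> fan_support F v ->
  f v = \sum_(i | [set i]%SET \in cones F) f (ray F i) * cone_coord v 0 i.
Proof.
move=> ppf vF; have [[c0 cF] vE] := coordP vF.
have [u uE] := pp1_cone ppf cF.
rewrite uE; last by apply/coneP; exists (cone_coord v).
rewrite {1}vE mul_ray_mx mulmx_suml summxE [RHS]big_mkcond; apply: eq_bigr => i _.
rewrite -scalemxAl mxE mulrC; case: ifPn => [iF|/(coord_nray vF) ->]; last by rewrite mulr0.
case: (eqVneq (cone_coord v 0 i) 0) => [->|ci]; first by rewrite !mulr0.
by rewrite uE //; apply: cone_ray; rewrite inE.
Qed.

End Simplicial.
End Fan.
(** * Functionals on piecewise polynomials *)

Section Functional.
Context (R : realType) (n m : nat).
Local Notation N := 'rV[R]_n.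
Local Notation fan := (fan_data R n m).
Implicit Types (F G : fan) (s t : {set 'I_m}) (c : 'rV[R]_m) (f g h : N -> R).
Local Notation pp := piecewise_poly.

(* On a Lefschetz fan these are the positive multiples of the degree map. Unlike
   degree maps, they are stable under [star_functional] without normalisation. *)
Definition pos_functional F k (E : (N -> R) -> R) :=
  [/\ (forall a f g, pp F k f -> pp F k g ->
         E (fun v => a * f v + g v) = a * E f + E g),
      (forall f, pp F k f -> linear_ideal F k f -> E f = 0)
    & (forall s, s \in cones F -> #|s| = k ->
         0 < E (fun v => \prod_(i in s) cone_coord F v 0 i))].

Section Theory.
Variables (F : fan) (k : nat) (E : (N -> R) -> R).
Hypothesis posE : pos_functional F k E.

Lemma functional0 : E (fun=> 0) = 0.
Proof.
have [_ idE _] := posE; apply: idE; first exact: pp0.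
case: k => [|k'] /=; first by move=> v _.
by exists (fun _ _ => 0) => [i|v _]; [exact: pp0|rewrite big1 // => i _; rewrite mulr0].
Qed.

Lemma functional_eq f g : pp F k f ->
  (forall v, fan_support F v -> f v = g v) -> E f = E g.
Proof.
have [linE idE _] := posE; move=> ppf fg; have ppg := pp_ext ppf fg.
have := linE (-1) f g ppf ppg; rewrite idE; first by move=> /eqP; lra.
  exact: ppD (ppZ (-1) ppf) ppg.
case: k => [|k'] /=; first by move=> v /fg ->; rewrite mulN1r addNr.
exists (fun _ _ => 0) => [i|v /fg ->]; first exact: pp0.
by rewrite mulN1r addNr big1 // => i _; rewrite mulr0.
Qed.

Lemma functionalZ a f : pp F k f -> E (fun v => a * f v) = a * E f.
Proof.
move=> ppf; have [linE _ _] := posE.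
have := linE a f _ ppf (@pp0 _ _ _ F k); rewrite functional0 addr0 => <-.
by apply: functional_eq => [|v _]; [exact: ppZ|rewrite addr0].
Qed.

Lemma functionalD f g : pp F k f -> pp F k g ->
  E (fun v => f v + g v) = E f + E g.
Proof.
move=> ppf ppg; have [linE _ _] := posE.
have := linE 1 f g ppf ppg; rewrite mul1r => <-.
by apply: functional_eq => [|v _]; [exact: ppD|rewrite mul1r].
Qed.

Lemma functionalB f g : pp F k f -> pp F k g ->
  E (fun v => f v - g v) = E f - E g.
Proof.
move=> ppf ppg; rewrite -mulN1r -functionalZ // -functionalD //; last exact: ppZ.
by apply: functional_eq => [|v _]; [exact: ppB|rewrite mulN1r].
Qed.

Lemma functional_sum (I : Type) (r : seq I) (P : pred I) (f : I -> N -> R) :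
  (forall i, P i -> pp F k (f i)) ->
  E (fun v => \sum_(i <- r | P i) f i v) = \sum_(i <- r | P i) E (f i).
Proof.
move=> ppf; elim: r => [|i r IHr].
  rewrite big_nil -[RHS]functional0; apply: functional_eq => [|v _].
    exact: pp_sum.
  by rewrite big_nil.
rewrite big_cons; case: ifPn => Pi.
  rewrite -IHr -functionalD; [|exact: ppf|exact: pp_sum].
  by apply: functional_eq => [|v _]; [exact: pp_sum|rewrite big_cons Pi].
rewrite -IHr; apply: functional_eq => [|v _]; first exact: pp_sum.
by rewrite big_cons (negbTE Pi).
Qed.

End Theory.

Lemma functional_lin F k E (u : 'cV[R]_n) f : pos_functional F k.+1 E ->
  pp F k f -> E (fun v => (v *m u) 0 0 * f v) = 0.
Proof.
move=> [_ idE _] ppf; apply: idE; first exact: (ppSM (@pp_lin _ _ _ F u) ppf).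
exists (fun i v => u i 0 * f v) => [i|v _]; first exact: ppZ.
by rewrite mxE mulr_suml; apply: eq_bigr => i _; rewrite mulrA.
Qed.

Lemma functional_expand F k E (u : 'cV[R]_n) f g : simplicial F ->
  pos_functional F k.+1 E -> pp F 1 f -> pp F k g ->
  E (fun v => f v * g v) = \sum_(i | [set i]%SET \in cones F)
    (f (ray F i) - (ray F i *m u) 0 0) * E (fun v => cone_coord F v 0 i * g v).
Proof.
move=> simpF posE ppf ppg.
pose fu v := f v - (v *m u) 0 0; have ppfu : pp F 1 fu by apply/ppB/pp_lin.
have -> : E (fun v => f v * g v) = E (fun v => fu v * g v).
  rewrite -[RHS]addr0 -(functional_lin u posE ppg) -(functionalD posE).
  - by apply: functional_eq posE _ _ _ _ => [|v _]; [exact: ppSM|rewrite /fu; ring].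
  - exact: ppSM.
  - exact/ppSM/ppg/pp_lin.
under eq_bigr => i _.
  rewrite -(functionalZ posE); last exact/ppSM/ppg/pp_coord.
  over.
rewrite -(functional_sum posE) /=; last first.
  by move=> i _; apply/ppZ/ppSM/ppg/pp_coord.
apply: functional_eq posE _ _ _ _ => [|v vF]; first exact: ppSM.
rewrite (pp1E simpF ppfu vF) mulr_suml; apply: eq_bigr => i _.
by rewrite /fu mulrA.
Qed.

End Functional.

(** * Stars and restriction *)

Section Star.
Context (R : realType) (n m : nat).
Local Notation N := 'rV[R]_n.
Local Notation fan := (fan_data R n m).
Implicit Types (F G : fan) (s t : {set 'I_m}) (c : 'rV[R]_m) (f g h : N -> R).
Local Notation pp := piecewise_poly.

Lemma ray_star F s : exists2 lam : 'I_m -> R, forall i, 0 < lam i &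
  forall i, ray (star F s) i = lam i *: quotient_map F s (ray F i).
Proof.
suff /fin_all_exists2[lam lam0 lamE] : forall i, exists2 a : R, 0 < a &
    ray (star F s) i = a *: quotient_map F s (ray F i) by exists lam.
move=> i; rewrite /= /primitive_generator; case: xgetP => [u _ [_ [a a0 uE]]|_].
  by exists a.
by exists 1; rewrite ?scale1r.
Qed.

Lemma mem_star F s t :
  (t \in cones (star F s)) = [disjoint t & s] && (t :|: s \in cones F).
Proof. by rewrite inE. Qed.

Lemma mem_closed_star F s t :
  (t \in cones (closed_star F s)) = (t :|: s \in cones F).
Proof. by rewrite inE. Qed.

Lemma row_diag_mx_mul (p : nat) (a : 'rV[R]_m) (A : 'M[R]_(m, p)) i :
  row i (diag_mx a *m A) = a 0 i *: row i A.
Proof. by rewrite mul_diag_mx; apply/rowP => j; rewrite !mxE. Qed.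

Lemma star_ray_mx F s : exists2 lam : 'rV[R]_m, forall i, 0 < lam 0 i &
  ray_mx (star F s) = diag_mx lam *m ray_mx F *m cokermx (cone_span F s).
Proof.
have [lam lam0 lamE] := ray_star F s; exists (\row_i lam i) => [i|].
  by rewrite mxE.
apply/row_matrixP => i; rewrite rowK lamE -mulmxA row_diag_mx_mul mxE.
by rewrite row_mul rowK.
Qed.

Lemma cone_span_ray_mx F s :
  cone_span F s = diag_mx (\row_i (i \in s)%:R) *m ray_mx F.
Proof.
apply/row_matrixP => i; rewrite row_diag_mx_mul !rowK mxE.
by case: (i \in s); rewrite (scale0r, scale1r).
Qed.

Lemma cone_span_coker F s (x : N) : x *m cokermx (cone_span F s) = 0 ->
  exists2 a, vsupp a \subset s & x = a *m ray_mx F.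
Proof.
move=> /eqP; rewrite -submxE => /submxP[a ->].
exists (a *m diag_mx (\row_i (i \in s)%:R)); last by rewrite cone_span_ray_mx mulmxA.
by apply/vsuppP => i /negbTE iNs; rewrite mul_mx_diag !mxE iNs mulr0.
Qed.

Lemma coker_cone_span F s a : vsupp a \subset s ->
  a *m ray_mx F *m cokermx (cone_span F s) = 0.
Proof.
move=> /vsuppP as_; apply/eqP; rewrite -submxE; apply/submxP; exists a.
rewrite cone_span_ray_mx mulmxA; congr (_ *m _).
apply/rowP => i; rewrite mul_mx_diag !mxE.
by case: (boolP (i \in s)) => [|/as_ ->]; rewrite ?mulr1 ?mul0r.
Qed.

Lemma coker_ray F s i : i \in s -> ray F i *m cokermx (cone_span F s) = 0.
Proof.
move=> si; rewrite -(delta_ray F) coker_cone_span //.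
apply/vsuppP => j; rewrite mxE /=; apply: contraNeq.
by rewrite pnatr_eq0 eqb0 negbK => /eqP ->.
Qed.

Lemma simplicial_star F s : simplicial F -> s \in cones F ->
  simplicial (star F s).
Proof.
move=> [F0 faceF injF] sF; split.
- by rewrite mem_star finset.set0U sF andbT -setI_eq0 finset.set0I.
- move=> t t'; rewrite !mem_star => /andP[ts tF] t't.
  by rewrite (disjointWl t't ts); apply: faceF tF _; apply: finset.setSU.
have [lam lam0 ->] := star_ray_mx F s.
move=> c c' [c0 /=]; rewrite mem_star => /andP[cs csF] [c'0].
rewrite mem_star => /andP[c's c'sF] /eqP.
rewrite -subr_eq0 -mulmxBl mulmxA [_ *m (diag_mx lam *m _)]mulmxA.
move=> /eqP/cone_span_coker[a /vsuppP as_ aE].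
pose pos (c : 'rV[R]_m) := \row_i Num.max (c 0 i) 0.
have aP i : a 0 i = pos a 0 i - pos (- a) 0 i.
  rewrite !mxE; case: (lerP 0 (a 0 i)) => ai; first by rewrite max_r ?subr0 // oppr_le0.
  by rewrite max_l ?oppr_ge0 ?ltW // sub0r opprK.
have coef (b e : 'rV[R]_m) : (forall i, 0 <= b 0 i) -> vsupp b :|: s \in cones F ->
    (forall i, i \notin s -> e 0 i = 0) -> cone_coef F (b *m diag_mx lam + pos e).
  move=> b0 bF es; split=> [i|].
    by rewrite mul_mx_diag !mxE addr_ge0 ?mulr_ge0 ?(ltW (lam0 i)) // le_max lexx orbT.
  apply: faceF bF _; apply/vsuppP => i; rewrite finset.in_setU negb_or => /andP[ib /es ei].
  by rewrite mul_mx_diag !mxE ei maxxx addr0; move: ib; rewrite inE negbK => /eqP ->; rewrite mul0r.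
have aNs i : i \notin s -> (- a) 0 i = 0 by move=> /as_; rewrite !mxE => ->; rewrite oppr0.
have eE : c *m diag_mx lam + pos (- a) - (c' *m diag_mx lam + pos a) =
    (c - c') *m diag_mx lam - a.
  rewrite mulmxBl; move: (c *m _) (c' *m _) => A B.
  by apply/rowP => i; have := aP i; rewrite !mxE; lra.
have : c *m diag_mx lam + pos (- a) = c' *m diag_mx lam + pos a.
  apply: injF (coef _ _ c0 csF aNs) (coef _ _ c'0 c'sF as_) _.
  by apply/eqP; rewrite -subr_eq0 -mulmxBl eE mulmxBl -aE subrr.
move=> /rowP ec; apply/rowP => i.
have disj (b : 'rV[R]_m) : [disjoint vsupp b & s] -> i \in s -> b 0 i = 0.
  move=> bs si; apply/eqP; rewrite -[_ == _]negbK; apply/negP => bi.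
  by have /negP := disjointFl bs si; rewrite inE.
case: (boolP (i \in s)) => [si|iNs]; first by rewrite !disj.
have := ec i; rewrite !mul_mx_diag !mxE (as_ _ iNs) oppr0 maxxx !addr0.
by apply: mulIf; rewrite gt_eqF.
Qed.

End Star.
Section StarRestriction.
Context (R : realType) (n m : nat).
Local Notation N := 'rV[R]_n.
Local Notation fan := (fan_data R n m).
Implicit Types (F G : fan) (s t : {set 'I_m}) (c : 'rV[R]_m) (f g h : N -> R).
Local Notation pp := piecewise_poly.

Lemma closed_star_supportP F s v : simplicial F ->
  fan_support (closed_star F s) v <-> exists c,
    [/\ forall i, 0 <= c 0 i, vsupp c :|: s \in cones F & v = c *m ray_mx F].
Proof.
move=> [_ faceF _]; split=> [[t]|[c [c0 cs ->]]].
  rewrite mem_closed_star => tsF /coneP[c [c0 ct ->]]; exists c; split=> //.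
  by apply: faceF tsF _; apply: finset.setSU.
exists (vsupp c); first by rewrite mem_closed_star.
by apply/coneP; exists c.
Qed.

Lemma closed_star_coef F s v : simplicial F -> fan_support (closed_star F s) v ->
  [/\ fan_support F v, vsupp (cone_coord F v) :|: s \in cones F &
      v = cone_coord F v *m ray_mx F].
Proof.
move=> simpF /(closed_star_supportP _ _ simpF)[c [c0 csF ->]].
have cF : cone_coef F c.
  have [_ faceF _] := simpF; split=> //; apply: faceF csF _; exact: finset.subsetUl.
by rewrite coordK //; split=> //; apply/(fan_supportP simpF); exists c.
Qed.

Lemma coord_closed_star F i v : simplicial F -> fan_support F v ->
  cone_coord F v 0 i != 0 -> fan_support (closed_star F [set i]%SET) v.
Proof.
move=> simpF /(coordP simpF)[[c0 cF] vE] vi; apply/closed_star_supportP => //.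
exists (cone_coord F v); split=> //; rewrite (finset.setUidPl _) //.
by rewrite finset.sub1set inE.
Qed.

Lemma quotient_mapE F s (lam c : 'rV[R]_m) : (forall i, 0 < lam 0 i) ->
  ray_mx (star F s) = diag_mx lam *m ray_mx F *m cokermx (cone_span F s) ->
  quotient_map F s (c *m ray_mx F) =
    (\row_i if i \in s then 0 else c 0 i / lam 0 i) *m ray_mx (star F s).
Proof.
move=> lam0 ->; rewrite mulmxA [_ *m (diag_mx lam *m _)]mulmxA.
apply/eqP; rewrite -subr_eq0 -!mulmxBl coker_cone_span //.
apply/vsuppP => i /negbTE iNs; rewrite mul_mx_diag !mxE iNs.
by rewrite divfK ?subrr // gt_eqF.
Qed.

Lemma quotient_cone F s t : t :|: s \in cones F ->
  t :\: s \in cones (star F s) /\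
  forall v, cone F t v -> cone (star F s) (t :\: s) (quotient_map F s v).
Proof.
move=> tsF; split.
  rewrite mem_star; apply/andP; split.
    rewrite -setI_eq0; apply/eqP/setP => i; rewrite !inE.
    by case: (i \in s); rewrite ?andbF.
  suff -> : t :\: s :|: s = t :|: s by [].
  by apply/setP => i; rewrite !inE; case: (i \in s); rewrite ?orbT.
move=> v /coneP[c [c0 /vsuppP ct ->]].
have [lam lam0 lamE] := star_ray_mx F s.
rewrite (quotient_mapE _ lam0 lamE); apply/coneP.
exists (\row_i if i \in s then 0 else c 0 i / lam 0 i); split=> //.
  by move=> i; rewrite mxE; case: ifP => // _; rewrite divr_ge0 // ltW.
apply/vsuppP => i; rewrite mxE inE; case: ifP => //= _ /ct ->.
by rewrite mul0r.
Qed.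

Lemma pp_quotient F s k g : pp (star F s) k g ->
  pp (closed_star F s) k (fun v => g (quotient_map F s v)).
Proof.
apply: pp_comp => t; rewrite mem_closed_star => /quotient_cone[tF tE].
by exists (t :\: s).
Qed.

Lemma pp_closed_star F s k f : simplicial F -> pp F k f -> pp (closed_star F s) k f.
Proof.
move=> [_ faceF _] ppf t; rewrite mem_closed_star => tsF.
by apply: ppf; apply: faceF tsF _; apply: finset.subsetUl.
Qed.

Lemma pp_coord_mul F i k h : simplicial F -> pp (closed_star F [set i]%SET) k h ->
  pp F k.+1 (fun v => cone_coord F v 0 i * h v).
Proof.
move=> simpF pph s sF; case: (boolP (i \in s)) => [si|iNs].
  have sF' : s \in cones (closed_star F [set i]%SET).
    by rewrite mem_closed_star (finset.setUidPl _) ?finset.sub1set.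
  have [p hp pE] := pph s sF'; have [q hq qE] := pp_coord simpF i sF.
  by exists (q * p) => [|v sv]; [exact: dhomogM hq hp|rewrite mevalM pE // qE].
exists 0 => [|v sv]; first exact: dhomog0.
by rewrite meval0 (vsuppP _ _ (coord_supp simpF sF sv)) ?mul0r.
Qed.

Lemma quotient_support F s v : fan_support (closed_star F s) v ->
  fan_support (star F s) (quotient_map F s v).
Proof.
move=> [t]; rewrite mem_closed_star => /quotient_cone[tF tE] tv.
by exists (t :\: s) => //; apply: tE.
Qed.

Lemma quotient_coord F s (lam : 'rV[R]_m) v i : simplicial F ->
  s \in cones F -> (forall i, 0 < lam 0 i) ->
  ray_mx (star F s) = diag_mx lam *m ray_mx F *m cokermx (cone_span F s) ->
  fan_support (closed_star F s) v ->
  cone_coord (star F s) (quotient_map F s v) 0 i =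
    if i \in s then 0 else cone_coord F v 0 i / lam 0 i.
Proof.
move=> simpF sF lam0 lamE vs; have [vF csF {1}->] := closed_star_coef simpF vs.
rewrite (quotient_mapE _ lam0 lamE) coordK ?mxE //; first exact: simplicial_star.
split=> [j|].
  by rewrite mxE; case: ifP => // _; rewrite divr_ge0 ?(coord_ge0 simpF) // ltW.
have -> : vsupp (\row_i if i \in s then 0 else cone_coord F v 0 i / lam 0 i) =
    vsupp (cone_coord F v) :\: s.
  apply/setP => j; rewrite !inE mxE; case: ifP => //=; first by rewrite eqxx.
  by rewrite mulf_eq0 invr_eq0 (gt_eqF (lam0 j)) orbF.
by have [] := quotient_cone csF.
Qed.

Definition star_restr F s f g := exists u : 'cV[R]_n,
  forall v, fan_support (closed_star F s) v ->
    f v - g (quotient_map F s v) = (v *m u) 0 0.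

Lemma star_restrictionP F s f g : star_restriction F s 1 f g <-> star_restr F s f g.
Proof. exact: linear_ideal1. Qed.

Lemma ray_closed_star F s i : simplicial F -> i |: s \in cones F ->
  fan_support (closed_star F s) (ray F i).
Proof.
move=> simpF isF; exists [set i]%SET; first by rewrite mem_closed_star.
by apply: cone_ray; rewrite finset.set11.
Qed.

Lemma star_restr_exists F s f : simplicial F -> s \in cones F -> pp F 1 f ->
  exists2 g, pp (star F s) 1 g & star_restr F s f g.
Proof.
move=> simpF sF ppf; have [u uE] := pp1_cone ppf sF.
have [lam lam0 lamE] := star_ray_mx F s.
pose fu v := f v - (v *m u) 0 0; have ppfu : pp F 1 fu by apply/ppB/pp_lin.
exists (fun y => \sum_(i | [set i]%SET \in cones F)
    lam 0 i * fu (ray F i) * cone_coord (star F s) y 0 i).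
  by apply: pp_sum => i _; apply/ppZ/pp_coord/simplicial_star.
exists u => v vs; have [vF csF vE] := closed_star_coef simpF vs.
have -> : f v = fu v + (v *m u) 0 0 by rewrite /fu subrK.
rewrite (pp1E simpF ppfu vF) addrAC -[RHS]add0r; congr (_ + _).
rewrite -sumrB big1 // => i iF; rewrite (quotient_coord i simpF sF lam0 lamE vs).
case: ifP => [si|_].
  have -> : fu (ray F i) = 0 by rewrite /fu uE ?subrr //; apply: cone_ray.
  by rewrite !(mulr0, mul0r) subrr.
by have lam_neq0 : lam 0 i != 0 by [rewrite gt_eqF]; field.
Qed.

End StarRestriction.
Section StarFunctional.
Context (R : realType) (n m : nat).
Local Notation N := 'rV[R]_n.
Local Notation fan := (fan_data R n m).
Implicit Types (F G : fan) (s t : {set 'I_m}) (c : 'rV[R]_m) (f g h : N -> R).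
Local Notation pp := piecewise_poly.

Definition star_functional F i (E : (N -> R) -> R) g :=
  E (fun v => cone_coord F v 0 i * g (quotient_map F [set i]%SET v)).

Lemma coord_mul_eq F i f g : simplicial F ->
  (forall v, fan_support (closed_star F [set i]%SET) v -> f v = g v) ->
  forall v, fan_support F v -> cone_coord F v 0 i * f v = cone_coord F v 0 i * g v.
Proof.
move=> simpF fg v vF; case: (eqVneq (cone_coord F v 0 i) 0) => [->|vi].
  by rewrite !mul0r.
by rewrite fg //; apply: coord_closed_star.
Qed.

Lemma pp_star_functional F i k g : simplicial F -> pp (star F [set i]%SET) k g ->
  pp F k.+1 (fun v => cone_coord F v 0 i * g (quotient_map F [set i]%SET v)).
Proof. by move=> simpF ppg; apply: pp_coord_mul => //; apply: pp_quotient. Qed.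

Lemma pos_functional_star F i k E : simplicial F -> [set i]%SET \in cones F ->
  pos_functional F k.+1 E -> pos_functional (star F [set i]%SET) k (star_functional F i E).
Proof.
move=> simpF iF posE; have [linE idE posE'] := posE; split.
- move=> a f g ppf ppg; rewrite -linE; try exact: pp_star_functional.
  apply: functional_eq posE _ _ _ _ => [|v _]; last by ring.
  exact: (@pp_star_functional F i k _ simpF (ppD (ppZ a ppf) ppg)).
- move=> g ppg idg; pose q := quotient_map F [set i]%SET.
  case: k {linE posE'} posE idE ppg idg => [|k] posE idE ppg /=.
    move=> g0; rewrite -[RHS](functional0 posE).
    apply: functional_eq posE _ _ _ _ => [|v vF]; first exact: pp_star_functional.
    rewrite (@coord_mul_eq F i (g \o q) (fun=> 0) simpF _ _ vF) ?mulr0 // => w.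
    by move=> /quotient_support/g0.
  move=> [h pph gE]; apply: idE; first exact: pp_star_functional.
  exists (fun l v => cone_coord F v 0 i *
      \sum_j cokermx (cone_span F [set i]%SET) l j * h j (q v)).
    move=> l; apply: pp_coord_mul => //.
    by apply: pp_sum => j _; apply: ppZ; apply: pp_quotient; apply: pph.
  move=> v vF; under eq_bigr do rewrite mulrCA.
  rewrite -mulr_sumr; move: v vF; apply: (coord_mul_eq simpF) => v /quotient_support/gE ->.
  under [RHS]eq_bigr do rewrite mulr_sumr.
  rewrite exchange_big /=; apply: eq_bigr => j _.
  by rewrite mxE mulr_suml; apply: eq_bigr => l _; rewrite mulrA.
move=> t; rewrite mem_star => /andP[ti tiF] tk.
have simpS := simplicial_star simpF iF.
have [lam lam0 lamE] := star_ray_mx F [set i]%SET.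
have iNt : i \notin t by rewrite (disjointFl ti) // finset.set11.
have tiE : t :|: [set i]%SET = i |: t by rewrite finset.setUC.
have -> : star_functional F i E (fun v => \prod_(j in t) cone_coord (star F [set i]%SET) v 0 j)
    = \prod_(j in t) (lam 0 j)^-1 * E (fun v => \prod_(j in i |: t) cone_coord F v 0 j).
  have ppE : pp F k.+1 (fun v => \prod_(j in i |: t) cone_coord F v 0 j).
    have <- : #|i |: t| = k.+1 by rewrite cardsU1 iNt tk.
    by apply: pp_prodset => j; apply: pp_coord.
  rewrite -(functionalZ posE) //; apply: functional_eq posE _ _ _ _ => [|v vF].
    rewrite -tk; apply: (@pp_star_functional F i _
      (fun v => \prod_(j in t) cone_coord (star F [set i]%SET) v 0 j) simpF).
    by apply: pp_prodset => j; apply: pp_coord.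
  rewrite big_setU1 //= [RHS]mulrCA; move: v vF; apply: (coord_mul_eq simpF) => v vs.
  rewrite -big_split /=; apply: eq_bigr => j jt.
  rewrite (quotient_coord j simpF iF lam0 lamE vs) mulrC; case: ifPn => //.
  by rewrite inE => /eqP ji; rewrite -ji jt in iNt.
rewrite mulr_gt0 //; first by rewrite prodr_gt0 // => j _; rewrite invr_gt0.
by apply: posE'; rewrite -?tiE // tiE cardsU1 iNt tk.
Qed.

Lemma star_functional_mul F i k E f g h : simplicial F ->
  pos_functional F k.+2 E -> pp F 1 f -> pp (star F [set i]%SET) 1 g ->
  star_restr F [set i]%SET f g -> pp (closed_star F [set i]%SET) k h ->
  E (fun v => cone_coord F v 0 i * (f v * h v)) =
  E (fun v => cone_coord F v 0 i * (g (quotient_map F [set i]%SET v) * h v)).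
Proof.
move=> simpF posE ppf ppg [u uE] pph.
have pp1h : pp F k.+2 (fun v => cone_coord F v 0 i * (f v * h v)).
  by apply: pp_coord_mul => //; apply: ppSM pph; apply: pp_closed_star.
have pp2h : pp F k.+2
    (fun v => cone_coord F v 0 i * (g (quotient_map F [set i]%SET v) * h v)).
  by apply: pp_coord_mul => //; apply: ppSM pph; apply: pp_quotient.
have ppih := pp_coord_mul simpF pph.
apply/eqP; rewrite -subr_eq0 -(functionalB posE) //.
rewrite -(functional_lin u posE ppih); apply/eqP.
apply: functional_eq posE _ _ _ _ => [|v vF]; first exact: ppB.
rewrite -mulrBr [RHS]mulrCA; move: v vF; apply: (coord_mul_eq simpF) => v /uE <-.
by rewrite mulrBl.
Qed.

Lemma star_functional_prod_mul F i k E (r : (N -> R) -> N -> R) ls h : simplicial F ->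
  (forall f, pp F 1 f -> pp (star F [set i]%SET) 1 (r f) /\ star_restr F [set i]%SET f (r f)) ->
  pos_functional F (size ls + k).+1 E -> List.Forall (pp F 1) ls ->
  pp (closed_star F [set i]%SET) k h ->
  E (fun v => cone_coord F v 0 i * (\prod_(l <- ls) l v * h v)) =
  E (fun v => cone_coord F v 0 i *
    (\prod_(l <- map r ls) l (quotient_map F [set i]%SET v) * h v)).
Proof.
move=> simpF rP; elim: ls k h => [|l ls IHls] k h posE ppls pph.
  by congr (E _); apply/funext => v; rewrite /= !big_nil.
have [ppl {}ppls] := (List.Forall_inv ppls, List.Forall_inv_tail ppls).
have [pprl resl] := rP l ppl.
rewrite /= in posE *.
transitivity (E (fun v => cone_coord F v 0 i * (l v * (\prod_(l <- ls) l v * h v)))).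
  by congr (E _); apply/funext => v; rewrite big_cons !mulrA.
rewrite (star_functional_mul simpF posE ppl pprl resl); last first.
  by apply: ppM pph; apply: pp_closed_star => //; apply: pp_prod.
pose h' v := r l (quotient_map F [set i]%SET v) * h v.
transitivity (E (fun v => cone_coord F v 0 i * (\prod_(l <- ls) l v * h' v))).
  by congr (E _); apply/funext => v; rewrite /h'; ring.
rewrite (IHls k.+1) //; first by congr (E _); apply/funext => v; rewrite big_cons /h'; ring.
  by rewrite addnS.
by apply: ppSM pph; apply: pp_quotient.
Qed.

Lemma star_functional_prod F i E (r : (N -> R) -> N -> R) ls : simplicial F ->
  (forall f, pp F 1 f -> pp (star F [set i]%SET) 1 (r f) /\ star_restr F [set i]%SET f (r f)) ->
  pos_functional F (size ls).+1 E -> List.Forall (pp F 1) ls ->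
  E (fun v => cone_coord F v 0 i * \prod_(l <- ls) l v) =
  star_functional F i E (fun v => \prod_(l <- map r ls) l v).
Proof.
move=> simpF rP posE ppls; have := @star_functional_prod_mul F i 0 E r ls (fun=> 1).
rewrite addn0 => /(_ simpF rP posE ppls (@pp1 _ _ _ _)); rewrite /star_functional.
by under eq_fun do rewrite mulr1; under [X in _ = E X]eq_fun do rewrite mulr1.
Qed.

Lemma star_restr_choice F s : simplicial F -> s \in cones F ->
  exists r : (N -> R) -> N -> R,
    forall f, pp F 1 f -> pp (star F s) 1 (r f) /\ star_restr F s f (r f).
Proof.
move=> simpF sF; suff /choice[r rP] : forall f, exists g,
    pp F 1 f -> pp (star F s) 1 g /\ star_restr F s f g by exists r.
move=> f; case: (pselect (pp F 1 f)) => [ppf|]; last by exists f.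
by have [g] := star_restr_exists simpF sF ppf; exists g.
Qed.

Lemma Forall_star F i (r : (N -> R) -> N -> R) ls :
  (forall f, pp F 1 f -> pp (star F [set i]%SET) 1 (r f) /\ star_restr F [set i]%SET f (r f)) ->
  List.Forall (pp F 1) ls -> List.Forall (pp (star F [set i]%SET) 1) (map r ls).
Proof.
by move=> rP; elim: ls => [|l ls IHls] /= H; constructor;
  [case: (rP l (List.Forall_inv H))|apply/IHls/(List.Forall_inv_tail H)].
Qed.

End StarFunctional.
(** * Positivity *)

Section Ample.
Context (R : realType) (n m : nat).
Local Notation N := 'rV[R]_n.
Local Notation fan := (fan_data R n m).
Implicit Types (F G : fan) (s t : {set 'I_m}) (c : 'rV[R]_m) (f g h l : N -> R)
  (ls : seq (N -> R)).
Local Notation pp := piecewise_poly.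

Lemma vsupp_mul_diag (c lam : 'rV[R]_m) : (forall i, 0 < lam 0 i) ->
  vsupp (c *m diag_mx lam) = vsupp c.
Proof.
move=> lam0; apply/setP => i; rewrite !inE mul_mx_diag mxE.
by rewrite mulf_eq0 (gt_eqF (lam0 i)) orbF.
Qed.

Lemma star_star_ker F s t (x : N) :
  x *m (cokermx (cone_span F s) *m cokermx (cone_span (star F s) t)) = 0 <->
  x *m cokermx (cone_span F (t :|: s)) = 0.
Proof.
have [lam lam0 lamE] := star_ray_mx F s; rewrite mulmxA; split.
  move=> /cone_span_coker[a /vsuppP at_]; rewrite lamE.
  rewrite mulmxA [a *m (diag_mx lam *m _)]mulmxA => /eqP.
  rewrite -subr_eq0 -mulmxBl => /eqP/cone_span_coker[b /vsuppP bs] /eqP.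
  rewrite subr_eq => /eqP ->; rewrite -mulmxDl coker_cone_span //.
  apply/vsuppP => i; rewrite inE negb_or => /andP[/at_ ait /bs bis].
  by rewrite mxE bis add0r mul_mx_diag mxE ait mul0r.
move=> /cone_span_coker[a /vsuppP ats ->].
have := quotient_mapE a lam0 lamE; rewrite /quotient_map => ->.
rewrite coker_cone_span //; apply/vsuppP => i /negbTE iNt.
rewrite mxE; case: ifPn => // /negbTE iNs.
by rewrite ats ?mul0r // inE iNt iNs.
Qed.

(* The star of t in the star of s is the star of the cone spanned by t and s,
   up to a linear map between the two models of the quotient. *)
Lemma star_star F s t : exists phi psi : 'M[R]_n,
  [/\ cokermx (cone_span F (t :|: s)) =
        cokermx (cone_span F s) *m cokermx (cone_span (star F s) t) *m phi,
      cokermx (cone_span F s) *m cokermx (cone_span (star F s) t) =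
        cokermx (cone_span F (t :|: s)) *m psi
    & forall r, r \in cones (star (star F s) t) ->
        r \in cones (star F (t :|: s)) /\
        forall y, cone (star (star F s) t) r y ->
          cone (star F (t :|: s)) r (y *m phi) /\ y *m phi *m psi = y].
Proof.
have [phi phiE] := factor_mx (fun x => iffLR (star_star_ker F s t x)).
have [psi psiE] := factor_mx (fun x => iffRL (star_star_ker F s t x)).
exists phi, psi; split; [exact: phiE|exact: psiE|move=> r].
rewrite !mem_star => /andP[rt /andP[rts rtsF]].
have rs : [disjoint r & s] by apply: disjointWl rts; apply: finset.subsetUl.
rewrite -finset.setUA in rtsF; split.
  rewrite rtsF andbT -setI_eq0 finset.setIUr.
  by move: rt rs; rewrite -!setI_eq0 => /eqP -> /eqP ->; rewrite finset.setU0.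
have [lam lam0 lamE] := star_ray_mx F s.
have [mu mu0 muE] := star_ray_mx (star F s) t.
have [nu nu0 nuE] := star_ray_mx F (t :|: s).
move=> y /coneP[c [c0 cr ->]]; rewrite muE lamE.
have -> : c *m (diag_mx mu *m (diag_mx lam *m ray_mx F *m cokermx (cone_span F s)) *m
    cokermx (cone_span (star F s) t)) = c *m diag_mx mu *m diag_mx lam *m ray_mx F *m
    (cokermx (cone_span F s) *m cokermx (cone_span (star F s) t)).
  rewrite -!(mulmxA c) -!(mulmxA (diag_mx mu)) -!(mulmxA (diag_mx lam)).
  by rewrite -!(mulmxA (ray_mx F)).
rewrite -[_ *m _ *m phi]mulmxA -phiE; split; last by rewrite -[_ *m _ *m psi]mulmxA -psiE.
apply/coneP.
exists (\row_i (c 0 i * mu 0 i * lam 0 i / nu 0 i)); split.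
- by move=> i; rewrite mxE divr_ge0 ?mulr_ge0 // ltW.
- by apply/vsuppP => i /(vsuppP _ _ cr) ci; rewrite mxE ci !mul0r.
rewrite nuE [RHS]mulmxA; congr (_ *m _); rewrite [RHS]mulmxA; congr (_ *m _).
apply/rowP => i.
by rewrite !mul_mx_diag !mxE divfK // gt_eqF.
Qed.

Lemma star_restr0 F s l g (u : 'cV[R]_n) : simplicial F -> s \in cones F ->
  pp (star F s) 1 g ->
  (forall v, fan_support (closed_star F s) v -> l v - g (quotient_map F s v) = (v *m u) 0 0) ->
  forall i, i \in s -> l (ray F i) = (ray F i *m u) 0 0.
Proof.
move=> simpF sF ppg gE i si; rewrite -gE; last first.
  by apply: ray_closed_star => //; rewrite (finset.setUidPr _) // finset.sub1set.
rewrite /quotient_map coker_ray // (pp1_at0 _ ppg) ?subr0 //.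
by have [S0 _ _] := simplicial_star simpF sF; apply/set0Pn; exists finset.set0.
Qed.

Lemma in_K_star F s l g : simplicial F -> s \in cones F -> in_K F l ->
  pp (star F s) 1 g -> star_restr F s l g -> in_K (star F s) g.
Proof.
move=> simpF sF [ppl lK] ppg [u1 u1E]; split=> // t tS.
have simpS := simplicial_star simpF sF.
have tsF : t :|: s \in cones F by move: tS; rewrite mem_star => /andP[].
have [h [pph /star_restrictionP[u2 u2E] h_gt0]] := lK _ tsF.
have [phi [psi [phiE psiE star2]]] := star_star F s t.
exists (fun y => h (y *m phi)); split.
- apply: pp_comp pph => r /star2[rF ry]; exists r; first exact: rF.
  by move=> v /ry[ryv _]; exact: ryv.
- have [|u' u'E] := @factor_mx R n n 1 (cokermx (cone_span F s)) (u2 - u1).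
    move=> x /cone_span_coker[b /vsuppP bs ->]; rewrite mul_ray_mx mulmx_suml big1 // => i _.
    case: (boolP (i \in s)) => [si|/bs ->]; last by rewrite scale0r mul0mx.
    rewrite -scalemxAl mulmxBr (_ : _ - _ = 0) ?scaler0 //.
    apply/rowP => j; rewrite !ord1 !mxE; apply/eqP; rewrite subr_eq0.
    have := star_restr0 simpF sF ppg u1E si; rewrite mxE => <-.
    have := star_restr0 simpF tsF pph u2E (_ : i \in _); rewrite mxE => <- //.
    by rewrite inE si orbT.
  apply/star_restrictionP; exists u' => y.
  move=> /(closed_star_supportP _ _ simpS)[c [c0]].
  rewrite mem_star => /andP[cts ctsF ->].
  have [lam lam0 lamE] := star_ray_mx F s.
  pose v := c *m diag_mx lam *m ray_mx F.
  have -> : c *m ray_mx (star F s) = quotient_map F s v.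
    by rewrite lamE /quotient_map /v -!(mulmxA c) -!(mulmxA (diag_mx lam)).
  have vts : fan_support (closed_star F (t :|: s)) v.
    apply/closed_star_supportP => //; exists (c *m diag_mx lam); split=> //.
      by move=> i; rewrite mul_mx_diag mxE mulr_ge0 // ltW.
    by rewrite vsupp_mul_diag // finset.setUA.
  have vs : fan_support (closed_star F s) v.
    have [_ faceF _] := simpF; apply/closed_star_supportP => //.
    exists (c *m diag_mx lam); split=> //.
      by move=> i; rewrite mul_mx_diag mxE mulr_ge0 // ltW.
    rewrite vsupp_mul_diag //; apply: faceF ctsF _; apply: finset.setSU.
    exact: finset.subsetUl.
  have -> : quotient_map (star F s) t (quotient_map F s v) *m phi =
      quotient_map F (t :|: s) v by rewrite /quotient_map phiE -!mulmxA.
  rewrite /quotient_map -[in RHS]mulmxA -u'E mulmxBr !mxE.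
  have := u1E _ vs; have := u2E _ vts; rewrite !mxE /quotient_map; lra.
- move=> y [r /star2[rF ry]] /ry[yr yE] y0; apply: h_gt0; first by exists r.
  by apply: contra_neq y0 => y0; rewrite -yE y0 mul0mx.
Qed.

Lemma in_K_pos F l : simplicial F -> in_K F l -> exists u : 'cV[R]_n,
  forall i, [set i]%SET \in cones F -> 0 < l (ray F i) - (ray F i *m u) 0 0.
Proof.
move=> simpF [_ lK]; have [F0 _ _] := simpF.
have [g [_ /star_restrictionP[u uE] g_gt0]] := lK _ F0.
exists u => i iF.
have iS : fan_support (closed_star F finset.set0) (ray F i).
  by apply: ray_closed_star => //; rewrite finset.setU0.
rewrite -uE // opprB addrC subrK; apply: g_gt0; first exact: quotient_support.
apply: contra_neq (ray_neq0 simpF iF) => /cone_span_coker[a].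
rewrite finset.subset0 => /eqP a0 ->.
suff -> : a = 0 by rewrite mul0mx.
by apply/rowP => j; rewrite mxE; apply/eqP; have /setP/(_ j) := a0; rewrite !inE => /negbFE.
Qed.

Lemma fan_dim_ge F s : s \in cones F -> (#|s| <= fan_dim F)%N.
Proof. by move=> sF; apply: leq_bigmax_cond. Qed.

Lemma fan_dim_cone F : simplicial F -> exists2 s, s \in cones F & #|s| = fan_dim F.
Proof.
move=> [F0 _ _]; have : (0 < #|cones F|)%N by apply/card_gt0P; exists finset.set0.
by move=> /(eq_bigmax_cond (fun s => #|s|))[s sF sE]; exists s; rewrite // -sE.
Qed.

Lemma fan_dim_star_lt F i : simplicial F -> [set i]%SET \in cones F ->
  (fan_dim (star F [set i]%SET) < fan_dim F)%N.
Proof.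
move=> simpF iF; have [t] := fan_dim_cone (simplicial_star simpF iF).
rewrite mem_star => /andP[ti tiF] <-; apply: leq_trans (fan_dim_ge tiF).
by rewrite finset.setUC cardsU1 (disjointFl ti) // finset.set11.
Qed.

Lemma fan_dim_star_ge F s i : i \in s -> s \in cones F ->
  (#|s| <= (fan_dim (star F [set i]%SET)).+1)%N.
Proof.
move=> si sF; rewrite (cardsD1 i) si add1n ltnS fan_dim_ge //.
by have [] := @quotient_cone _ _ _ F [set i]%SET s; rewrite ?(finset.setUidPl _) ?finset.sub1set.
Qed.

Lemma functional_vanish F E (ls : seq (N -> R)) : simplicial F ->
  pos_functional F (size ls) E -> List.Forall (pp F 1) ls ->
  (fan_dim F < size ls)%N -> E (fun v => \prod_(l <- ls) l v) = 0.
Proof.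
elim: {ls}(size ls) {-2}ls (erefl (size ls)) F E => [|k IHk] [|l ls] // [lsk] F E simpF posE.
move=> ppls dimF; rewrite /= lsk in posE dimF.
have [ppl {}ppls] := (List.Forall_inv ppls, List.Forall_inv_tail ppls).
have -> : E (fun v => \prod_(l <- l :: ls) l v) = E (fun v => l v * \prod_(l <- ls) l v).
  by congr (E _); apply/funext => v; rewrite big_cons.
rewrite (functional_expand 0 simpF posE ppl) -?lsk; last exact: pp_prod.
rewrite big1 // => i iF; have [r rP] := star_restr_choice simpF iF.
rewrite (star_functional_prod simpF rP) ?lsk //.
rewrite (IHk (map r ls) _ (star F [set i]%SET) (star_functional F i E)) ?mulr0 ?size_map ?lsk //.
- exact: simplicial_star.
- exact: pos_functional_star.
- exact: Forall_star.
by rewrite -ltnS; apply: leq_trans dimF; apply: fan_dim_star_lt.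
Qed.

Lemma Forall_in_K_pp F (ls : seq (N -> R)) :
  List.Forall (in_K F) ls -> List.Forall (pp F 1) ls.
Proof. by apply: List.Forall_impl => l []. Qed.

Lemma Forall_in_K_star F i (r : (N -> R) -> N -> R) ls :
  simplicial F -> [set i]%SET \in cones F ->
  (forall f, pp F 1 f -> pp (star F [set i]%SET) 1 (r f) /\ star_restr F [set i]%SET f (r f)) ->
  List.Forall (in_K F) ls -> List.Forall (in_K (star F [set i]%SET)) (map r ls).
Proof.
move=> simpF iF rP; elim: ls => [|l ls IHls] H /=; constructor.
  have lK := List.Forall_inv H; have [pprl resl] := rP l (proj1 lK).
  exact: in_K_star resl.
exact/IHls/(List.Forall_inv_tail H).
Qed.

Lemma functional_coord_prod_step F i E ls : simplicial F -> [set i]%SET \in cones F ->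
  pos_functional F (size ls).+1 E -> List.Forall (in_K F) ls ->
  (fan_dim F <= (size ls).+1)%N ->
  (forall E' ls', size ls' = size ls -> pos_functional (star F [set i]%SET) (size ls') E' ->
    List.Forall (in_K (star F [set i]%SET)) ls' ->
    fan_dim (star F [set i]%SET) = size ls' -> 0 < E' (fun v => \prod_(l <- ls') l v)) ->
  0 <= E (fun v => cone_coord F v 0 i * \prod_(l <- ls) l v) ?= iff
    (fan_dim (star F [set i]%SET) != size ls).
Proof.
move=> simpF iF posE lsK dimF pos_star; have ppls := Forall_in_K_pp lsK.
have [r rP] := star_restr_choice simpF iF; have simpS := simplicial_star simpF iF.
have posS := pos_functional_star simpF iF posE.
rewrite (star_functional_prod simpF rP) //.
have := leq_trans (fan_dim_star_lt simpF iF) dimF.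
rewrite ltnS leq_eqVlt => /orP[/eqP dimS|dimS].
  suff p : 0 < star_functional F i E (fun v => \prod_(l <- map r ls) l v).
    by split; rewrite ?ltW // dimS eqxx lt_eqF.
  apply: pos_star; rewrite ?size_map //.
  exact: Forall_in_K_star rP lsK.
rewrite (@functional_vanish (star F [set i]%SET) (star_functional F i E)) ?size_map //.
  by split; rewrite // eqxx ltn_eqF.
exact: Forall_star.
Qed.

Lemma functional_prod_gt0 F E (ls : seq (N -> R)) : simplicial F ->
  pos_functional F (size ls) E -> List.Forall (in_K F) ls ->
  fan_dim F = size ls -> 0 < E (fun v => \prod_(l <- ls) l v).
Proof.
elim: {ls}(size ls) {-2}ls (erefl (size ls)) F E => [|k IHk] [|l ls] // => [_|[lsk]] F E simpF posE.
  move=> _ _; have [_ _ /(_ finset.set0)] := posE; have [F0 _ _] := simpF.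
  rewrite cards0 => /(_ F0 erefl); congr (_ < E _).
  by apply/funext => v; rewrite big_set0 big_nil.
move=> lsK dimF; rewrite /= lsk in posE dimF.
have [lK {}lsK] := (List.Forall_inv lsK, List.Forall_inv_tail lsK).
have ppls := Forall_in_K_pp lsK.
have -> : E (fun v => \prod_(l <- l :: ls) l v) = E (fun v => l v * \prod_(l <- ls) l v).
  by congr (E _); apply/funext => v; rewrite big_cons.
have [u u_gt0] := in_K_pos simpF lK.
rewrite (functional_expand u simpF posE (proj1 lK)) -?lsk; last exact: pp_prod.
have term i (iF : [set i]%SET \in cones F) :
    0 <= E (fun v => cone_coord F v 0 i * \prod_(l <- ls) l v) ?= iff
      (fan_dim (star F [set i]%SET) != k).
  rewrite -lsk; apply: functional_coord_prod_step; rewrite ?dimF ?lsk // => E' ls' ls'k.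
  by apply: (IHk ls' _ (star F [set i]%SET) E'); rewrite ?ls'k //; exact: simplicial_star.
have [s sF] := fan_dim_cone simpF; rewrite dimF => sk.
have [i si] : exists i, i \in s by apply/card_gt0P; rewrite sk.
have iF := ray_cone simpF si sF.
rewrite (bigD1 i) //= ltr_pwDl //; last first.
  by apply: sumr_ge0 => j /andP[jF _]; rewrite mulr_ge0 ?(ltW (u_gt0 _ jF)) ?term.
rewrite mulr_gt0 ?u_gt0 // lt_def term // andbT eq_sym term // negbK.
rewrite eqn_leq -ltnS -dimF fan_dim_star_lt //=.
by rewrite -ltnS -sk fan_dim_star_ge.
Qed.

Lemma functional_coord_prod F i E ls : simplicial F -> [set i]%SET \in cones F ->
  pos_functional F (size ls).+1 E -> List.Forall (in_K F) ls ->
  (fan_dim F <= (size ls).+1)%N ->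
  0 <= E (fun v => cone_coord F v 0 i * \prod_(l <- ls) l v) ?= iff
    (fan_dim (star F [set i]%SET) != size ls).
Proof.
move=> simpF iF posE lsK dimF; apply: functional_coord_prod_step => // E' ls' _.
exact/functional_prod_gt0/simplicial_star.
Qed.

End Ample.
(** * The Bochner method *)

Section Bochner.
Context (K : realFieldType) (m : nat).
Implicit Types (M : 'M[K]_m) (x y : 'rV[K]_m) (S U : {set 'I_m}).

Definition bilin M x y : K := (x *m M *m y^T) 0 0.

Lemma bilinE M x y : bilin M x y = \sum_i (x *m M) 0 i * y 0 i.
Proof. by rewrite /bilin mxE; apply: eq_bigr => i _; congr (_ * _); rewrite mxE. Qed.

Lemma bilinC M x y : M^T = M -> bilin M x y = bilin M y x.
Proof.
move=> symM; rewrite /bilin -[x *m M *m _]trmxK mxE !trmx_mul trmxK symM.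
by rewrite mulmxA.
Qed.

Lemma psd_cauchy_schwarz M x y : M^T = M -> (forall z, 0 <= bilin M z z) ->
  bilin M x y ^+ 2 <= bilin M x x * bilin M y y.
Proof.
move=> symM psdM.
have expand a b : bilin M (a *: x + b *: y) (a *: x + b *: y) =
    a ^+ 2 * bilin M x x + 2 * a * b * bilin M x y + b ^+ 2 * bilin M y y.
  transitivity (a * a * bilin M x x + a * b * bilin M x y +
      (b * a * bilin M y x + b * b * bilin M y y)); last first.
    by rewrite (bilinC y x symM); ring.
  rewrite /bilin linearD !mulmxDl !linearZ /= -!scalemxAl !mulmxDr -!scalemxAr.
  by rewrite !mxE; ring.
have [y0|y0] := ltrP 0 (bilin M y y); last first.
  have {}y0 : bilin M y y = 0 by apply/eqP; rewrite eq_le y0 psdM.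
  rewrite y0 mulr0; case: (eqVneq (bilin M x y) 0) => [->|xy]; first by rewrite expr0n.
  have := psdM (1 *: x - ((bilin M x x + 1) / (2 * bilin M x y)) *: y).
  rewrite -scaleNr expand y0.
  have -> : 1 ^+ 2 * bilin M x x + 2 * 1 * - ((bilin M x x + 1) / (2 * bilin M x y)) *
      bilin M x y + (- ((bilin M x x + 1) / (2 * bilin M x y))) ^+ 2 * 0 = -1.
    by field.
  by rewrite ler0N1.
have := psdM (bilin M y y *: x - bilin M x y *: y).
rewrite -scaleNr expand.
have -> : bilin M y y ^+ 2 * bilin M x x + 2 * bilin M y y * - bilin M x y * bilin M x y +
    (- bilin M x y) ^+ 2 * bilin M y y =
    bilin M y y * (bilin M x x * bilin M y y - bilin M x y ^+ 2) by ring.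
by rewrite pmulr_rge0 // subr_ge0.
Qed.

(* With D the diagonal matrix with entries p i / a i and B = 1 - D^-1 Q, the
   Perron-Frobenius argument shows that B is positive semidefinite for the
   inner product of D, with kernel spanned by a. The hypothesis says B^2 >= B,
   hence B >= 1 on the orthogonal complement of a. *)
Lemma bochner_hyperbolic S (Q : 'M[K]_m) (a p : 'I_m -> K) :
  Q^T = Q -> (forall i j, i \notin S -> Q i j = 0) ->
  (forall i, 0 < a i) -> (forall i, p i = \sum_j Q i j * a j) ->
  (forall i, i \in S -> 0 < p i) -> (forall i j, i != j -> 0 <= Q i j) ->
  (forall U, U \subset S -> U != finset.set0 -> U != S ->
     exists i j, [/\ i \in U, j \in S :\: U & 0 < Q i j]) ->
  (forall x, bilin Q x x <= \sum_(i in S) a i / p i * (x *m Q) 0 i ^+ 2) ->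
  forall x, \sum_i x 0 i * p i = 0 -> bilin Q x x <= 0.
Proof.
move=> symQ QS a0 pE p0 Q0 conn bochner x xp.
have symQE i j : Q i j = Q j i by rewrite -{1}symQ mxE.
have QS' i j : j \notin S -> Q i j = 0 by move=> jS; rewrite symQE QS.
pose del i := if i \in S then p i / a i else 1.
have del0 i : 0 < del i by rewrite /del; case: ifP => // iS; rewrite divr_gt0 ?p0.
pose M := diag_mx (\row_i del i) - Q.
have symM : M^T = M by rewrite /M linearB /= tr_diag_mx symQ.
have mulM y i : (y *m M) 0 i = del i * y 0 i - (y *m Q) 0 i.
  by rewrite /M mulmxBr mxE mul_mx_diag !mxE mulrC.
have bilinM y : bilin M y y = \sum_i del i * y 0 i ^+ 2 - bilin Q y y.
  rewrite !bilinE -sumrB; apply: eq_bigr => i _; rewrite mulM; ring.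
have sqM y : bilin M y y = \sum_(i | i \notin S) y 0 i ^+ 2 +
    2^-1 * \sum_i \sum_j Q i j * a i * a j * (y 0 i / a i - y 0 j / a j) ^+ 2.
  have delE : \sum_i del i * y 0 i ^+ 2 = \sum_(i | i \notin S) y 0 i ^+ 2 +
      \sum_i \sum_j Q i j * a i * a j * (y 0 i / a i) ^+ 2.
    rewrite (bigID (mem S)) /= addrC; congr (_ + _).
      by apply: eq_bigr => i /negbTE iS; rewrite /del iS mul1r.
    rewrite [RHS](bigID (mem S)) /= [X in _ = _ + X]big1 ?addr0 => [|i iS]; last first.
      by rewrite big1 // => j _; rewrite QS // !mul0r.
    apply: eq_bigr => i iS; rewrite /del iS pE 2!mulr_suml.
    apply: eq_bigr => j _; have := a0 i; move: (a i) => b b0; field.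
    by rewrite gt_eqF.
  have QE : bilin Q y y =
      \sum_i \sum_j Q i j * a i * a j * (y 0 i / a i * (y 0 j / a j)).
    rewrite bilinE exchange_big /=; apply: eq_bigr => j _; rewrite mxE mulr_suml.
    apply: eq_bigr => i _; have := a0 i; have := a0 j; move: (a i) (a j) => b e e0 b0.
    by field; rewrite !gt_eqF.
  rewrite bilinM delE QE -addrA; congr (_ + _).
  have symE : \sum_i \sum_j Q i j * a i * a j * (y 0 i / a i) ^+ 2 =
      \sum_i \sum_j Q i j * a i * a j * (y 0 j / a j) ^+ 2.
    rewrite exchange_big /=; apply: eq_bigr => i _; apply: eq_bigr => j _.
    by rewrite symQE; congr (_ * _); ring.
  have -> : \sum_i \sum_j Q i j * a i * a j * (y 0 i / a i - y 0 j / a j) ^+ 2 =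
      \sum_i \sum_j Q i j * a i * a j * (y 0 i / a i) ^+ 2 +
      \sum_i \sum_j Q i j * a i * a j * (y 0 j / a j) ^+ 2 -
      2 * \sum_i \sum_j Q i j * a i * a j * (y 0 i / a i * (y 0 j / a j)).
    rewrite mulr_sumr -big_split -sumrB; apply: eq_bigr => i _ /=.
    rewrite mulr_sumr -big_split -sumrB; apply: eq_bigr => j _ /=; ring.
  by rewrite -symE; field.
have term_ge0 y i j : 0 <= Q i j * a i * a j * (y 0 i / a i - y 0 j / a j) ^+ 2.
  case: (eqVneq i j) => [->|ij]; first by rewrite subrr expr0n mulr0.
  by apply: mulr_ge0 (sqr_ge0 _); rewrite !mulr_ge0 ?Q0 // ltW.
have psdM y : 0 <= bilin M y y.
  rewrite sqM addr_ge0 ?sumr_ge0 // => [i _|]; first exact: sqr_ge0.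
  by rewrite mulr_ge0 ?invr_ge0 ?ler0n // sumr_ge0 // => i _; rewrite sumr_ge0.
have kerM y : y *m M = 0 -> exists b, forall i, y 0 i = if i \in S then b * a i else 0.
  move=> yM; have /eqP : bilin M y y = 0 by rewrite /bilin yM mul0mx mxE.
  rewrite sqM paddr_eq0; last 2 first.
  - by rewrite sumr_ge0 // => i _; exact: sqr_ge0.
  - by rewrite mulr_ge0 ?invr_ge0 ?ler0n // sumr_ge0 // => i _; rewrite sumr_ge0.
  rewrite mulf_eq0 invr_eq0 pnatr_eq0 /= !psumr_eq0 => [/andP[/allP yS /allP yQ]| |]; last 2 first.
  - by move=> i _; rewrite sumr_ge0.
  - by move=> i _; exact: sqr_ge0.
  have {}yS i : i \notin S -> y 0 i = 0.
    by move=> iS; apply/eqP; have := yS i (mem_index_enum _); rewrite iS sqrf_eq0.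
  have {}yQ i j : 0 < Q i j -> y 0 i / a i = y 0 j / a j.
    move=> Qij; have := yQ i (mem_index_enum _); rewrite /= psumr_eq0 => [/allP/(_ j)|k _ //].
    rewrite mem_index_enum => /(_ isT) /=; rewrite mulf_eq0 sqrf_eq0 subr_eq0.
    by rewrite gt_eqF ?mulr_gt0 //= => /eqP.
  have [S0|/set0Pn[k kS]] := eqVneq S finset.set0.
    by exists 0 => i; rewrite S0 inE yS // S0 inE.
  exists (y 0 k / a k) => i; case: ifPn => [iS|/yS //].
  pose U := [set j in S | y 0 j / a j == y 0 k / a k]%SET.
  have [US|US] := eqVneq U S.
    by move: iS; rewrite -US inE => /andP[_ /eqP <-]; rewrite divfK // gt_eqF.
  have [||i' [j [i'U jU Qij]]] := conn U _ _ US.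
  - by apply/fintype.subsetP => j; rewrite inE => /andP[].
  - by apply/set0Pn; exists k; rewrite inE kS eqxx.
  move: i'U jU; rewrite !inE => /andP[_ /eqP <-] /andP[+ jS].
  by rewrite jS (yQ _ _ Qij) eqxx.
pose e : 'rV[K]_m := \row_i (if i \in S then x 0 i else 0).
have eQ : bilin Q e e = bilin Q x x.
  have eQx : e *m Q = x *m Q.
    apply/rowP => j; rewrite !mxE; apply: eq_bigr => i _; rewrite mxE.
    by case: ifPn => // iS; rewrite QS // !mulr0.
  rewrite /bilin eQx -/(bilin Q x e) bilinC // /bilin eQx.
  by rewrite -/(bilin Q x x).
pose De : 'rV[K]_m := \row_i (del i * e 0 i).
have /submxP[z zE] : (De <= M)%MS.
  rewrite submxE; apply/eqP/rowP => k; rewrite mxE [RHS]mxE.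
  pose y := (col k (cokermx M))^T.
  have [|b bE] := kerM y.
    by apply: trmx_inj; rewrite trmx_mul /y trmxK symM colE mulmxA mulmx_coker mul0mx trmx0.
  transitivity (b * \sum_i x 0 i * p i); last by rewrite xp mulr0.
  rewrite mulr_sumr; apply: eq_bigr => i _.
  have -> : cokermx M i k = y 0 i by rewrite !mxE.
  rewrite bE !mxE /del; case: ifPn => iS; last first.
    by rewrite pE big1 ?mulr0 // => j _; rewrite QS ?mul0r.
  by have := a0 i; move: (a i) => c c0; field; rewrite gt_eqF.
pose nrm := \sum_i del i * e 0 i ^+ 2.
have ze : bilin M z e = nrm.
  by rewrite bilinE -zE; apply: eq_bigr => i _; rewrite [De _ _]mxE; ring.
have zz : bilin M z z <= nrm.
  have -> : nrm = \sum_i (del i)^-1 * (z *m M) 0 i ^+ 2.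
    apply: eq_bigr => i _; rewrite -zE [De _ _]mxE; have := del0 i; move: (del i) => c c0.
    by field; rewrite gt_eqF.
  have -> : \sum_i (del i)^-1 * (z *m M) 0 i ^+ 2 =
      \sum_i del i * z 0 i ^+ 2 - 2 * bilin Q z z +
      \sum_(i in S) a i / p i * (z *m Q) 0 i ^+ 2.
    have -> : \sum_(i in S) a i / p i * (z *m Q) 0 i ^+ 2 =
        \sum_i (del i)^-1 * (z *m Q) 0 i ^+ 2.
      rewrite big_mkcond; apply: eq_bigr => i _ /=; rewrite /del; case: ifPn => iS.
        by rewrite invf_div.
      rewrite mxE big1 ?expr0n ?mulr0 // => j _; by rewrite QS' ?mulr0.
    rewrite bilinE mulr_sumr -sumrB -big_split; apply: eq_bigr => i _ /=.
    rewrite mulM; have := del0 i; move: (del i) => c c0.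
    by field; rewrite gt_eqF.
  by rewrite bilinM; have := bochner z; lra.
have nrm0 : 0 <= nrm by rewrite sumr_ge0 // => i _; rewrite mulr_ge0 ?sqr_ge0 // ltW.
have := psd_cauchy_schwarz z e symM psdM; rewrite ze => cs.
have {}cs : nrm ^+ 2 <= nrm * bilin M e e.
  by apply: le_trans cs _; rewrite ler_wpM2r.
have [nrm_gt0|nrm_le0] := ltrP 0 nrm.
  by move: cs; rewrite expr2 ler_pM2l // bilinM -/nrm -eQ; lra.
have := psdM e; rewrite bilinM -/nrm -eQ; lra.
Qed.

End Bochner.

Section Connectedness.
Context (R : realType) (n m : nat).
Implicit Types (F : fan_data R n m) (U : {set 'I_m}).

Definition top_rays F : {set 'I_m} :=
  [set i | [exists s in cones F, (#|s| == fan_dim F) && (i \in s)]]%SET.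

Lemma top_raysP F i : reflect
  (exists s, [/\ s \in cones F, #|s| = fan_dim F & i \in s]) (i \in top_rays F).
Proof.
rewrite inE; apply: (iffP exists_inP) => [[s sF /andP[/eqP sd si]]|[s [sF sd si]]].
  by exists s.
by exists s; rewrite // sd eqxx.
Qed.

(* Otherwise the restriction of w to the cones that meet U would be a Minkowski
   weight that is not a multiple of w. *)
Lemma top_rays_connected F w U : simplicial F -> fundamental_weight F w ->
  (2 <= fan_dim F)%N -> U \subset top_rays F -> U != finset.set0 -> U != top_rays F ->
  exists i j s, [/\ i \in U, j \in top_rays F :\: U, s \in cones F,
    #|s| = fan_dim F & (i \in s) && (j \in s)].
Proof.
move=> [F0 faceF _] [mw w_gt0 w_uniq] d2 US /set0Pn[i0 i0U] UnS.
have /set0Pn[j0 j0U] : top_rays F :\: U != finset.set0.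
  apply: contra_neq UnS => /eqP; rewrite finset.setD_eq0 => SU.
  by apply/eqP; rewrite finset.eqEsubset US.
apply: contrapT => noedge.
have sep i j (s : {set 'I_m}) : i \in U -> j \in s -> j \notin U -> s \in cones F ->
    #|s| = fan_dim F -> i \in s -> False.
  move=> iU js jU sF sd si; apply: noedge; exists i, j, s; split=> //.
    by rewrite inE jU; apply/top_raysP; exists s.
  by rewrite si.
pose w' (s : {set 'I_m}) := if [disjoint s & U] then 0 else w s.
have [|c cE] := w_uniq w'.
  move=> t tF td; pose b : R := if [disjoint t & U] then 0 else 1.
  have := congr1 (fun x => b *: x) (mw t tF td); rewrite scaler0 scaler_sumr => bmw.
  rewrite -[RHS]bmw;  apply: eq_bigr => i.
  move=> /andP[it itF]; rewrite scalerA; congr (_ *: _); rewrite /w' /b.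
  have itd : #|i |: t| = fan_dim F by rewrite cardsU1 it.
  case: ifPn => [itU|itU].
    by rewrite (disjointWl _ itU) ?mul0r // finset.subsetUr.
  case: ifPn => [tU|_]; last by rewrite mul1r.
  have [j jt] : exists j, j \in t.
    by apply/card_gt0P; rewrite -ltnS td.
  move: itU; rewrite -setI_eq0 => /set0Pn[k]; rewrite !inE => /andP[/orP[/eqP ->|kt] kU].
    apply: False_ind; apply: (sep i j (i |: t)) => //.
    + by rewrite finset.in_setU jt orbT.
    + by rewrite (disjointFr tU jt).
    + by rewrite finset.setU11.
  by rewrite (disjointFr tU kt) in kU.
have /top_raysP[s0 [s0F s0d i0s]] := fintype.subsetP US _ i0U.
have := j0U; rewrite inE => /andP[j0nU /top_raysP[s1 [s1F s1d j0s]]].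
have := cE _ s0F s0d; rewrite /w'; case: ifPn => [/disjointFr/(_ i0s)|_ c1].
  by rewrite i0U.
have {c1} c1 : c = 1.
  by apply: (mulIf (lt0r_neq0 (w_gt0 _ s0F s0d))); rewrite mul1r.
have := cE _ s1F s1d; rewrite /w'; case: ifPn => [_|].
  by rewrite c1 mul1r => /esym/eqP; rewrite gt_eqF // w_gt0.
rewrite -setI_eq0 => /set0Pn[k]; rewrite !inE => /andP[ks kU] _.
exact: (sep k j0 s1).
Qed.

End Connectedness.
(** * The Lorentzian inequality on K(F) *)

Section Lorentzian.
Context (R : realType) (n m : nat).
Local Notation N := 'rV[R]_n.
Local Notation fan := (fan_data R n m).
Implicit Types (F G : fan) (s t : {set 'I_m}) (f g h l : N -> R) (ls : seq (N -> R)).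
Local Notation pp := piecewise_poly.

Lemma degree_pos_functional F w deg : simplicial F ->
  fundamental_weight F w -> degree_map F w deg -> pos_functional F (fan_dim F) deg.
Proof.
move=> simpF [_ w_gt0 _] [lin_deg deg0 _ deg_w]; split=> //.
  move=> f ppf idf; apply/(deg0 f ppf); rewrite /chow_eq.
  by under eq_fun do rewrite subr0.
move=> s sF sd; have := deg_w s (fun i v => cone_coord F v 0 i) sF sd.
have courant i : i \in s -> courant_function F i (fun v => cone_coord F v 0 i).
  move=> si; split=> [|j jF]; first exact: pp_coord.
  by rewrite coord_ray // mxE eqxx eq_sym.
move=> /(_ courant) degE; have := w_gt0 s sF sd; rewrite -degE => wm.
rewrite ltNge; apply/negP => deg_le0; move: wm; rewrite ltNge => /negP; apply.
by rewrite mulr_le0_ge0.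
Qed.

Lemma pos_functional_degree F w deg E : simplicial F ->
  fundamental_weight F w -> degree_map F w deg -> pos_functional F (fan_dim F) E ->
  exists2 c, 0 < c & forall f, pp F (fan_dim F) f -> E f = c * deg f.
Proof.
move=> simpF fw dm posE; have posd := degree_pos_functional simpF fw dm.
have [_ deg0 deg_surj _] := dm; have [f1 ppf1 f11] := deg_surj 1.
have EE f : pp F (fan_dim F) f -> E f = E f1 * deg f.
  move=> ppf; apply/eqP; rewrite -subr_eq0 [E f1 * _]mulrC -(functionalZ posE) //.
  have ppg : pp F (fan_dim F) (fun v => f v - deg f * f1 v) by exact/ppB/ppZ.
  rewrite -(functionalB posE) //; last exact: ppZ.
  have [_ idE _] := posE; apply/eqP/idE => //.
  have : deg (fun v => f v - deg f * f1 v) = 0.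
    rewrite (functionalB posd) //; last exact: ppZ.
    by rewrite (functionalZ posd) // f11 mulr1 subrr.
  move=> /(deg0 _ ppg); rewrite /chow_eq.
  by under eq_fun do rewrite subr0.
exists (E f1) => //; have [s sF sd] := fan_dim_cone simpF.
have [_ _ /(_ s sF sd)] := posE; have [_ _ /(_ s sF sd)] := posd.
rewrite EE; last by rewrite -sd; apply: pp_prodset => i; apply: pp_coord.
by move=> d0; rewrite pmulr_lgt0.
Qed.

Definition qform E ls f g : R := E (fun v => f v * (g v * \prod_(l <- ls) l v)).

Section QForm.
Variables (F : fan) (E : (N -> R) -> R) (ls : seq (N -> R)).
Hypothesis posE : pos_functional F (size ls).+2 E.
Hypothesis ppls : List.Forall (pp F 1) ls.
Local Notation q := (qform E ls).

Lemma pp_qform f g : pp F 1 f -> pp F 1 g ->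
  pp F (size ls).+2 (fun v => f v * (g v * \prod_(l <- ls) l v)).
Proof. by move=> ppf ppg; apply/(ppSM ppf)/(ppSM ppg)/pp_prod. Qed.

Lemma qformC f g : q f g = q g f.
Proof. by congr (E _); apply/funext => v; ring. Qed.

Lemma qformBZ (a : R) f g h : pp F 1 f -> pp F 1 g -> pp F 1 h ->
  q (fun v => f v - a * g v) h = q f h - a * q g h.
Proof.
move=> ppf ppg pph; have [ppfh ppgh] := (pp_qform ppf pph, pp_qform ppg pph).
rewrite /qform -(functionalZ posE a ppgh) -(functionalB posE ppfh (ppZ a ppgh)).
by congr (E _); apply/funext => v; ring.
Qed.

Lemma qform_reverse_cs p f g : pp F 1 p ->
  (forall f, pp F 1 f -> q f p = 0 -> q f f <= 0) ->
  pp F 1 f -> pp F 1 g -> 0 < q g g -> q f f * q g g <= q f g ^+ 2.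
Proof.
move=> ppp hyp ppf ppg g0; have [gp|gp] := eqVneq (q g p) 0.
  by have := hyp g ppg gp; rewrite leNgt g0.
pose t := q f p / q g p.
have ppfg : pp F 1 (fun v => f v - t * g v) by exact/ppB/ppZ.
have : q (fun v => f v - t * g v) p = 0 by rewrite qformBZ // /t divfK // subrr.
move=> /(hyp _ ppfg); rewrite qformBZ // (qformC f) (qformC g) !qformBZ //.
rewrite (qformC g f) => le0.
have : q g g * (q f f - t * q f g - t * (q f g - t * q g g)) <= 0.
  by rewrite pmulr_rle0.
rewrite -subr_ge0; have := sqr_ge0 (t * q g g - q f g).
have -> : q g g * (q f f - t * q f g - t * (q f g - t * q g g)) =
  (t * q g g - q f g) ^+ 2 + q f f * q g g - q f g ^+ 2 by ring.
lra.
Qed.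

End QForm.

Lemma qform_prod E ls f g : qform E ls f g = E (fun v => \prod_(l <- f :: g :: ls) l v).
Proof. by congr (E _); apply/funext => v; rewrite !big_cons. Qed.

Lemma hodge_riemann_dim2 F E l f : simplicial F -> lefschetz F -> fan_dim F = 2%N ->
  pos_functional F 2 E -> in_K F l -> pp F 1 f ->
  qform E [::] f l = 0 -> qform E [::] f f <= 0.
Proof.
move=> simpF [w deg fw dm _ _ hr _] dimF posE lK ppf.
have posE' := posE; rewrite -dimF in posE'.
have [c c0 EE] := pos_functional_degree simpF fw dm posE'.
have [_ deg0 _ _] := dm; rewrite dimF in EE deg0.
have ppl := proj1 lK; have ppq := @pp_qform F [::] (List.Forall_nil _).
rewrite /qform (EE _ (ppq _ _ ppf ppl)) (EE _ (ppq _ _ ppf ppf)).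
move=> /eqP; rewrite mulf_eq0 gt_eqF //= => /eqP degfl.
rewrite pmulr_rle0 //.
have [f0|nf0] := pselect (chow_eq F 1 f (fun=> 0)).
  move: f0; rewrite /chow_eq => /linear_ideal1[u uE].
  suff -> : deg (fun v => f v * (f v * \prod_(h <- [::]) h v)) = 0 by [].
  apply/deg0; first exact: ppq.
  exists (fun i v => u i 0 * f v) => [i|v /uE]; first exact: ppZ.
  rewrite subr0 => fE; rewrite big_nil mulr1 subr0 {1}fE mxE mulr_suml.
  by apply: eq_bigr => i _; rewrite mulrA.
have := hr 1%N l; rewrite dimF => /(_ isT lK f ppf).
have -> : (fun x => l x ^+ (2 - 1.*2).+1 * f x) =
    (fun v => f v * (l v * \prod_(h <- [::]) h v)).
  by apply/funext => v; rewrite big_nil subnn expr1; ring.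
have -> : (fun x => l x ^+ (2 - 1.*2) * f x * f x) =
    (fun v => f v * (f v * \prod_(h <- [::]) h v)).
  by apply/funext => v; rewrite big_nil subnn expr0; ring.
move=> hrf; apply: ltW; rewrite -oppr_gt0 -mulN1r -[X in X * _]expr1; apply: hrf.
  by apply/deg0; first exact: ppq.
exact: nf0.
Qed.

End Lorentzian.
Section Induction.
Context (R : realType) (n m : nat).
Local Notation N := 'rV[R]_n.
Local Notation fan := (fan_data R n m).
Implicit Types (F G : fan) (s t : {set 'I_m}) (f g h l : N -> R) (ls : seq (N -> R)).
Local Notation pp := piecewise_poly.
Local Notation x_ F i := (fun v => cone_coord F v 0 i).

Lemma qform_star F E ls i (r : (N -> R) -> N -> R) f g : simplicial F ->
  (forall f, pp F 1 f -> pp (star F [set i]%SET) 1 (r f) /\ star_restr F [set i]%SET f (r f)) ->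
  pos_functional F (size ls).+3 E -> List.Forall (pp F 1) ls -> pp F 1 f -> pp F 1 g ->
  E (fun v => cone_coord F v 0 i * (f v * (g v * \prod_(l <- ls) l v))) =
  qform (star_functional F i E) (map r ls) (r f) (r g).
Proof.
move=> simpF rP posE ppls ppf ppg.
rewrite qform_prod -[r f :: _]/(map r (f :: g :: ls)) -star_functional_prod //.
  by congr (E _); apply/funext => v; rewrite !big_cons.
by constructor=> //; constructor.
Qed.

Lemma star_restr_coord F i j (lam : 'rV[R]_m) : simplicial F -> [set i]%SET \in cones F ->
  (forall i, 0 < lam 0 i) ->
  ray_mx (star F [set i]%SET) =
    diag_mx lam *m ray_mx F *m cokermx (cone_span F [set i]%SET) -> i != j ->
  star_restr F [set i]%SET (x_ F j) (fun y => lam 0 j * cone_coord (star F [set i]%SET) y 0 j).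
Proof.
move=> simpF iF lam0 lamE ij; exists 0 => v vs; rewrite mulmx0 mxE.
rewrite (quotient_coord j simpF iF lam0 lamE vs) inE eq_sym (negbTE ij).
by rewrite mulrC divfK ?subrr // gt_eqF.
Qed.

Lemma star_mem_ray F i j : [set j]%SET \in cones (star F [set i]%SET) =
  (i != j) && ([set i; j]%SET \in cones F).
Proof.
by rewrite mem_star disjoints1 inE eq_sym finset.setUC.
Qed.

Lemma functional_not_top F E i ls : simplicial F ->
  pos_functional F (size ls).+1 E -> List.Forall (pp F 1) ls ->
  fan_dim F = (size ls).+1 -> i \notin top_rays F ->
  E (fun v => cone_coord F v 0 i * \prod_(l <- ls) l v) = 0.
Proof.
move=> simpF posE ppls dimF iS.
have [iF|iF] := boolP ([set i]%SET \in cones F); last first.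
  rewrite -[RHS](functional0 posE).
  apply: (functional_eq posE) => [|v vF]; first exact/ppSM/pp_prod/ppls/pp_coord.
  by rewrite (coord_nray simpF vF iF) mul0r.
have [r rP] := star_restr_choice simpF iF; have simpS := simplicial_star simpF iF.
rewrite (star_functional_prod simpF rP) //.
apply: (@functional_vanish _ _ _ (star F [set i]%SET) (star_functional F i E)) => //.
- by rewrite size_map; exact: pos_functional_star.
- exact: Forall_star.
rewrite size_map ltnNge; apply: contra iS => dimS; apply/top_raysP.
have [t] := fan_dim_cone simpS; rewrite mem_star => /andP[ti tiF] td.
exists (t :|: [set i]%SET); split=> //; last by rewrite !inE eqxx orbT.
apply/eqP; rewrite eqn_leq fan_dim_ge //= dimF finset.setUC cardsU1.
by rewrite (disjointFl ti) ?finset.set11 // td.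
Qed.

Section Entries.
Variables (F : fan) (E : (N -> R) -> R) (ls : seq (N -> R)).
Hypotheses (simpF : simplicial F) (posE : pos_functional F (size ls).+2 E).
Hypotheses (lsK : List.Forall (in_K F) ls) (dimF : fan_dim F = (size ls).+2).
Local Notation q := (qform E ls).
Let ppls := Forall_in_K_pp lsK.

Lemma qform_nray i f : pp F 1 f -> [set i]%SET \notin cones F -> q (x_ F i) f = 0.
Proof.
move=> ppf iF; rewrite -[RHS](functional0 posE); apply: functional_eq posE _ _ _ _.
  by apply: pp_qform => //; apply: pp_coord.
by move=> v vF; rewrite (coord_nray simpF vF iF) mul0r.
Qed.

Lemma qform_expand (u : 'cV[R]_n) f g : pp F 1 f -> pp F 1 g ->
  q f g = \sum_i (f (ray F i) - (ray F i *m u) 0 0) * q (x_ F i) g.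
Proof.
move=> ppf ppg; rewrite {1}/qform.
rewrite (functional_expand u simpF posE ppf); last exact/(ppSM ppg)/pp_prod.
rewrite big_mkcond; apply: eq_bigr => i _; case: ifPn => // iF.
by rewrite qform_nray // mulr0.
Qed.

Lemma qform_not_top i f : pp F 1 f -> i \notin top_rays F -> q (x_ F i) f = 0.
Proof.
move=> ppf iS; have := @functional_not_top F E i (f :: ls) simpF posE.
have ppfls : List.Forall (pp F 1) (f :: ls) by constructor.
move=> /(_ ppfls dimF iS) <-.
by congr (E _); apply/funext => v; rewrite big_cons.
Qed.

Lemma qform_coord_gt0 i l : in_K F l -> i \in top_rays F -> 0 < q (x_ F i) l.
Proof.
move=> lK /top_raysP[s [sF sd si]]; have iF := ray_cone simpF si sF.
have -> : q (x_ F i) l = E (fun v => cone_coord F v 0 i * \prod_(l <- l :: ls) l v).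
  by congr (E _); apply/funext => v; rewrite big_cons.
have := @functional_coord_prod _ _ _ F i E (l :: ls) simpF iF posE.
have llsK : List.Forall (in_K F) (l :: ls) by constructor.
move=> /(_ llsK); rewrite dimF => /(_ (leqnn _))[ge0 eq0].
rewrite lt_def ge0 andbT eq_sym eq0 negbK eqn_leq.
have := fan_dim_star_lt simpF iF; rewrite dimF ltnS => -> /=.
by have := fan_dim_star_ge si sF; rewrite sd dimF.
Qed.

Lemma qform_offdiag i j : i != j ->
  0 <= q (x_ F i) (x_ F j) /\
  (forall s, s \in cones F -> #|s| = fan_dim F -> i \in s -> j \in s ->
    0 < q (x_ F i) (x_ F j)).
Proof.
move=> ij; have ppj : pp F 1 (x_ F j) by apply: pp_coord.
have [iF|iF] := boolP ([set i]%SET \in cones F); last first.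
  rewrite qform_nray //; split=> // s sF _ si.
  by rewrite (ray_cone simpF si sF) in iF.
have simpS := simplicial_star simpF iF.
have [r rP] := star_restr_choice simpF iF.
have [lam lam0 lamE] := star_ray_mx F [set i]%SET.
have restrj := star_restr_coord simpF iF lam0 lamE ij.
have ppS : pp (star F [set i]%SET) 1
  (fun y => lam 0 j * cone_coord (star F [set i]%SET) y 0 j) by apply/ppZ/pp_coord.
have posS := pos_functional_star simpF iF posE.
have qE : q (x_ F i) (x_ F j) = lam 0 j * star_functional F i E
    (fun y => cone_coord (star F [set i]%SET) y 0 j * \prod_(l <- map r ls) l y).
  rewrite -(functionalZ posS); last first.
    rewrite -(size_map r); apply: ppSM; first exact: pp_coord.
    exact/pp_prod/Forall_star.
  rewrite /qform (star_functional_mul simpF posE ppj ppS restrj); last first.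
    exact/pp_closed_star/pp_prod.
  have ppSq := pp_quotient ppS.
  have posE' : pos_functional F (size ls + 1).+1 E by rewrite addn1.
  have := star_functional_prod_mul simpF rP posE' ppls ppSq.
  move=> EE; transitivity (E (fun v => cone_coord F v 0 i * (\prod_(l <- ls) l v *
      (lam 0 j * cone_coord (star F [set i]%SET) (quotient_map F [set i]%SET v) 0 j)))).
    by congr (E _); apply/funext => v; ring.
  by rewrite EE; congr (E _); apply/funext => v; ring.
have [jS|jS] := boolP ([set j]%SET \in cones (star F [set i]%SET)); last first.
  have q0 : q (x_ F i) (x_ F j) = 0.
    rewrite qE -[X in _ * X = _](_ : 0 = _) ?mulr0 // -(functional0 posS).
    apply/esym; apply: (functional_eq posS) => [|v vS].
      rewrite -(size_map r); apply: ppSM; first exact: pp_coord.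
      exact/pp_prod/Forall_star.
    by rewrite (coord_nray simpS vS jS) mul0r.
  rewrite q0; split=> // s sF _ si sj; case/negP: jS.
  have [_ faceF _] := simpF; rewrite star_mem_ray ij /=; apply: faceF sF _.
  by apply/fintype.subsetP => k; rewrite !inE => /orP[] /eqP ->.
have dimS := fan_dim_star_lt simpF iF; rewrite dimF ltnS -(size_map r) in dimS.
have posS' := posS; rewrite -(size_map r) in posS'.
have [ge0 eq0] := functional_coord_prod simpS jS posS' (Forall_in_K_star simpF iF rP lsK) dimS.
split=> [|s sF sd si sj]; first by rewrite qE mulr_ge0 // ltW.
rewrite qE mulr_gt0 // lt_def ge0 andbT eq_sym eq0 negbK.
have siS : s :\ i \in cones (star F [set i]%SET).
  by have [] := @quotient_cone _ _ _ F [set i]%SET s; rewrite ?(finset.setUidPl _) ?finset.sub1set.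
have jsi : j \in s :\ i by rewrite !inE eq_sym ij.
have := fan_dim_star_ge jsi siS.
have -> : #|s :\ i| = (size ls).+1.
  by apply/eqP; rewrite -eqSS -dimF -sd [in X in _ == X](cardsD1 i) si.
rewrite ltnS eqn_leq size_map => ->; rewrite andbT -ltnS.
by apply: leq_trans (fan_dim_star_lt simpS jS) _; rewrite size_map in dimS.
Qed.

End Entries.

Lemma bilin_qform F E ls (simpF : simplicial F) (posE : pos_functional F (size ls).+2 E)
    (lsK : List.Forall (in_K F) ls) f : pp F 1 f ->
  let Q := \matrix_(i, j) qform E ls (x_ F i) (x_ F j) in
  let y := \row_i f (ray F i) in
  qform E ls f f = bilin Q y y /\ forall i, (y *m Q) 0 i = qform E ls (x_ F i) f.
Proof.
move=> ppf Q y.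
have yQ i : (y *m Q) 0 i = qform E ls (x_ F i) f.
  rewrite qformC (qform_expand simpF posE lsK 0 ppf); last exact: pp_coord.
  by rewrite mxE; apply: eq_bigr => j _; rewrite mulmx0 !mxE subr0.
split=> //; rewrite bilinE (qform_expand simpF posE lsK 0 ppf ppf).
by apply: eq_bigr => i _; rewrite yQ mulmx0 !mxE subr0 mulrC.
Qed.

Lemma lefschetz_lorentzian F E l ls f : simplicial F -> lefschetz F ->
  fan_dim F = (size ls).+2 -> pos_functional F (size ls).+2 E ->
  in_K F l -> List.Forall (in_K F) ls -> pp F 1 f ->
  qform E ls f f * qform E ls l l <= qform E ls f l ^+ 2.
Proof.
elim: {ls}(size ls) {-2}ls (erefl (size ls)) F E l f => [|k IHk].
  case=> // _ F E l f simpF lefF dimF posE lK _ ppf; have ppl := proj1 lK.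
  apply: (qform_reverse_cs posE (List.Forall_nil _) ppl) => //.
    by move=> g ppg; exact: (hodge_riemann_dim2 simpF lefF dimF posE lK ppg).
  rewrite qform_prod; apply: (functional_prod_gt0 simpF) => //.
  by do 3?[apply: List.Forall_cons => // | apply: List.Forall_nil].
case=> // l3 ls [lsk] F E l f simpF lefF dimF posE lK llsK ppf.
have [l3K lsK] := (List.Forall_inv llsK, List.Forall_inv_tail llsK).
have ppls := Forall_in_K_pp lsK; have pplls := Forall_in_K_pp llsK.
have [ppl3 ppl] := (proj1 l3K, proj1 lK).
apply: (qform_reverse_cs posE pplls ppl3) => //; last first.
  rewrite qform_prod; apply: (functional_prod_gt0 simpF) => //.
  by do 2?apply: List.Forall_cons => //.
move=> {ppf}f ppf fl3.
have [u u_gt0] := in_K_pos simpF l3K.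
pose q := qform E (l3 :: ls).
pose a i := if [set i]%SET \in cones F then l3 (ray F i) - (ray F i *m u) 0 0 else 1.
pose p i := q (x_ F i) l3.
pose Q := \matrix_(i, j) q (x_ F i) (x_ F j).
have ppx i : pp F 1 (x_ F i) by apply: pp_coord.
have [fE yQ] := bilin_qform simpF posE llsK ppf.
have qxl g : pp F 1 g -> q l3 g = \sum_i a i * q (x_ F i) g.
  move=> ppg; rewrite /q (qform_expand simpF posE llsK u ppl3 ppg).
  apply: eq_bigr => i _; rewrite /a; case: ifPn => // iF.
  by rewrite (qform_nray simpF posE llsK ppg iF) !mulr0.
have [w deg fw dm _ _ _ lef_star] := lefF.
rewrite fE; apply: (@bochner_hyperbolic _ _ (top_rays F) Q a p).
- by apply/matrixP => i j; rewrite !mxE /q qformC.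
- by move=> i j iS; rewrite mxE /q (qform_not_top simpF posE llsK dimF).
- by move=> i; rewrite /a; case: ifPn => // /u_gt0.
- move=> i; rewrite /p /q qformC -/q qxl //; apply: eq_bigr => j _.
  by rewrite mxE mulrC; congr (_ * _); exact: qformC.
- by move=> i iS; apply: qform_coord_gt0.
- by move=> i j ij; rewrite mxE; case: (qform_offdiag simpF posE llsK dimF ij).
- move=> U US U0 UnS.
  have [|i [j [s [iU jU sF sd /andP[si sj]]]]] := top_rays_connected simpF fw _ US U0 UnS.
    by rewrite dimF.
  exists i, j; split=> //; rewrite mxE.
  have ij : i != j by apply: contraTneq jU => <-; rewrite inE iU.
  by have [_] := qform_offdiag simpF posE llsK dimF ij; apply; eauto.
- move=> y; pose g v := \sum_i y 0 i * cone_coord F v 0 i.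
  have ppg : pp F 1 g by apply: pp_sum => i _; apply: ppZ.
  have gE i : [set i]%SET \in cones F -> g (ray F i) = y 0 i.
    move=> iF; rewrite /g (bigD1 i) //= coord_ray // mxE !eqxx mulr1 big1 ?addr0 //.
    by move=> j ji; rewrite mxE (negbTE ji) andbF mulr0.
  have [gqE gQ] := bilin_qform simpF posE llsK ppg.
  have yg : y *m Q = (\row_i g (ray F i)) *m Q.
    apply/rowP => j; rewrite !mxE; apply: eq_bigr => i _; rewrite !mxE.
    case: (boolP ([set i]%SET \in cones F)) => [/gE ->//|iF].
    by rewrite /q (qform_nray simpF posE llsK (ppx j) iF) !mulr0.
  have -> : bilin Q y y = q g g.
    have symQ : Q^T = Q by apply/matrixP => i j; rewrite !mxE /q qformC.
    rewrite /q gqE /bilin yg -!/(bilin Q _ _) bilinC //.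
    by rewrite /bilin yg.
  have -> : q g g = \sum_i a i *
      E (fun v => cone_coord F v 0 i * (g v * (g v * \prod_(l <- ls) l v))).
    transitivity (E (fun v => l3 v * (g v * (g v * \prod_(l <- ls) l v)))).
      by congr (E _); apply/funext => v; rewrite big_cons; ring.
    have ppggls : pp F (size (l3 :: ls)).+1 (fun v => g v * (g v * \prod_(l <- ls) l v)).
      exact/(ppSM ppg)/(ppSM ppg)/pp_prod.
    rewrite (functional_expand u simpF posE ppl3 ppggls) [LHS]big_mkcond.
    apply: eq_bigr => i _; rewrite /a; case: ifPn => // iF.
    rewrite -[X in 1 * X](_ : 0 = _) ?mulr0 // -(functional0 posE).
    apply/esym; apply: (functional_eq posE) => [|v vF]; first exact: ppSM ppggls.
    by rewrite (coord_nray simpF vF iF) mul0r.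
  have nS i : i \notin top_rays F ->
      E (fun v => cone_coord F v 0 i * (g v * (g v * \prod_(l <- ls) l v))) = 0.
    move=> iS; have ppggls : List.Forall (pp F 1) (g :: g :: ls).
      by do 2?apply: List.Forall_cons => //.
    rewrite -[RHS](@functional_not_top F E i (g :: g :: ls) simpF posE ppggls dimF iS).
    by congr (E _); apply/funext => v; rewrite !big_cons.
  rewrite (bigID (mem (top_rays F))) /= [X in _ + X]big1 ?addr0; last first.
    by move=> i iS; rewrite nS ?mulr0.
  apply: ler_sum => i iS.
  have /top_raysP[s [sF sd si]] := iS.
  have iF := ray_cone simpF si sF.
  have pi0 : 0 < p i by apply: qform_coord_gt0.
  have ai0 : 0 < a i by rewrite /a iF u_gt0.
  rewrite -mulrA ler_pM2l // mulrC ler_pdivlMr // yg gQ.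
  have [r rP] := star_restr_choice simpF iF.
  have -> : p i = E (fun v => cone_coord F v 0 i * (l3 v * (l3 v * \prod_(l <- ls) l v))).
    by congr (E _); apply/funext => v; rewrite big_cons.
  have -> : qform E (l3 :: ls) (x_ F i) g =
      E (fun v => cone_coord F v 0 i * (g v * (l3 v * \prod_(l <- ls) l v))).
    by congr (E _); apply/funext => v; rewrite big_cons.
  rewrite !(qform_star simpF rP posE ppls) //.
  have simpS := simplicial_star simpF iF.
  have dimS : fan_dim (star F [set i]%SET) = (size (map r ls)).+2.
    apply/eqP; rewrite size_map eqn_leq -ltnS -[X in (_ < X)%N]dimF fan_dim_star_lt //=.
    by have := fan_dim_star_ge si sF; rewrite sd dimF.
  apply: (IHk _ _ (star F [set i]%SET)) => //.
  + by rewrite size_map.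
  + by apply: lef_star => //; apply/set0Pn; exists i; rewrite inE.
  + by rewrite size_map; apply: pos_functional_star.
  + by have [pprl resl] := rP _ ppl3; apply: in_K_star resl.
  + exact: Forall_in_K_star rP lsK.
  + by case: (rP _ ppg).
- by rewrite -[RHS]fl3 (qform_expand simpF posE llsK 0 ppf ppl3); apply: eq_bigr => i _;
    rewrite mulmx0 !mxE subr0.
Qed.

End Induction.
(** * Passing to the closure of K(F) *)

Section Closure.
Context (R : realType) (n m : nat).
Local Notation N := 'rV[R]_n.
Local Notation fan := (fan_data R n m).
Implicit Types (F : fan) (s t : {set 'I_m}) (f g h l : N -> R) (ls : seq (N -> R)).
Local Notation pp := piecewise_poly.
Local Notation x_ F i := (fun v => cone_coord F v 0 i).

Lemma cone_span_free F s (a : 'rV[R]_m) : \rank (cone_span F s) = #|s| ->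
  vsupp a \subset s -> a *m ray_mx F = 0 -> a = 0.
Proof.
rewrite cone_span_ray_mx; set D := diag_mx _ => rk /vsuppP as_ a0.
have rkD : (\rank D <= #|s|)%N.
  have -> : D = \sum_(i in s) delta_mx i i.
    apply/matrixP => i j; rewrite !mxE summxE.
    under eq_bigr do rewrite mxE.
    case: (boolP (i \in s)) => [si|iNs].
      rewrite (bigD1 i) //= eqxx big1 ?addr0 => [|k /andP[_ ki]].
        by rewrite eq_sym /=; case: eqP.
      by rewrite eq_sym (negbTE ki).
    rewrite mul0rn big1 // => k ks.
    by case: eqP => // ik; rewrite ik ks in iNs.
  rewrite -sum1_card; elim/big_rec2: _ => [|i r A _ rA]; first by rewrite mxrank0.
  by apply: leq_trans (mxrank_add _ _) _; rewrite mxrank_delta leq_add.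
have /eqP : (\rank (D :&: kermx (ray_mx F)) = 0)%N.
  by apply/eqP; rewrite -leqn0 -(leq_add2l (\rank (D *m ray_mx F))) mxrank_mul_ker addn0 rk.
rewrite mxrank_eq0 => /eqP cap0; apply/eqP; rewrite -submx0 -cap0 sub_capmx.
apply/andP; split; last by apply/sub_kermxP.
apply/submxP; exists a; apply/rowP => i; rewrite mul_mx_diag !mxE.
by case: (boolP (i \in s)) => [|/as_ ->]; rewrite ?mulr1 ?mul0r.
Qed.

Lemma rational_simplicial F : rational_simplicial_fan F -> simplicial F.
Proof.
move=> [_ _ rk [F0 faceF] meetF]; split=> // c c' [c0 cF] [c'0 c'F] cc'.
have : (cone F (vsupp c) `&` cone F (vsupp c'))%classic (c *m ray_mx F).
  by split; apply/coneP; [exists c|exists c'].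
rewrite meetF // => /coneP[b [_]]; rewrite finset.subsetI => /andP[/vsuppP bc /vsuppP bc'] e.
have uniq (a : 'rV[R]_m) : vsupp a \in cones F ->
    (forall i, i \notin vsupp a -> b 0 i = 0) -> a *m ray_mx F = b *m ray_mx F -> a = b.
  move=> aF ba ab; apply/eqP; rewrite -subr_eq0; apply/eqP.
  apply: (cone_span_free (rk _ aF)); last by rewrite mulmxBl ab subrr.
  apply/vsuppP => i ia; rewrite !mxE ba // subr0.
  by move: ia; rewrite inE negbK => /eqP.
by rewrite (uniq c) // (uniq c') // -cc'.
Qed.

Lemma closure_ge0 (A : set 'rV[R]_m) (h : 'rV[R]_m -> R) : continuous h ->
  (forall v, A v -> 0 <= h v) -> forall v, closure A v -> 0 <= h v.
Proof.
move=> ch Ah v Av.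
have /closure_id cl : closed [set w | 0 <= h w]%classic.
  apply: (closed_comp (f := h) (D := [set x | 0 <= x]%classic)) => [w _|].
    exact: ch.
  exact: closed_ge.
have : closure [set w | 0 <= h w]%classic v by apply: closure_subset Av => w /Ah.
by rewrite -cl.
Qed.

Lemma continuous_coord_sum (c : 'I_m -> R) :
  continuous (fun v : 'rV[R]_m => \sum_i v 0 i * c i).
Proof.
apply: continuous_big => [|i _ v]; first exact: add_continuous.
by apply: cvgMr_tmp; [exact: nbhs_filter|exact: (@coord_continuous R 1 m 0 i v)].
Qed.

Lemma continuous_mul_sub (h1 h2 h3 h4 : 'rV[R]_m -> R) :
  continuous h1 -> continuous h2 -> continuous h3 -> continuous h4 ->
  continuous (fun v => h1 v * h2 v - h3 v * h4 v).
Proof.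
move=> c1 c2 c3 c4 v.
exact: (continuousB (continuousM (c1 v) (c2 v)) (continuousM (c3 v) (c4 v))).
Qed.

Lemma functional_ray_values F k E f g : simplicial F -> pos_functional F k.+1 E ->
  pp F 1 f -> pp F k g ->
  E (fun v => f v * g v) =
  \sum_i ray_values F f 0 i * E (fun v => cone_coord F v 0 i * g v).
Proof.
move=> simpF posE ppf ppg; rewrite (functional_expand 0 simpF posE ppf ppg).
rewrite big_mkcond; apply: eq_bigr => i _; rewrite [ray_values _ _ _ _]mxE; case: ifPn => _.
  by rewrite mulmx0 !mxE subr0.
by rewrite mul0r.
Qed.

Section Limit.
Variables (F : fan) (E : (N -> R) -> R) (f : N -> R).
Hypotheses (simpF : simplicial F) (lefF : lefschetz F) (ppf : pp F 1 f).

Lemma lorentzian_closure_fst l ls : fan_dim F = (size ls).+2 ->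
  pos_functional F (size ls).+2 E -> in_closure_K F l -> List.Forall (in_K F) ls ->
  qform E ls f f * qform E ls l l <= qform E ls f l ^+ 2.
Proof.
move=> dimF posE [ppl lK] lsK; have ppls := Forall_in_K_pp lsK.
pose c i := qform E ls (x_ F i) f; pose b i j := qform E ls (x_ F i) (x_ F j).
pose h (v : 'rV[R]_m) := (\sum_i v 0 i * c i) * (\sum_i v 0 i * c i) -
  qform E ls f f * \sum_j v 0 j * \sum_i v 0 i * b i j.
have hE g : pp F 1 g ->
    h (ray_values F g) = qform E ls f g ^+ 2 - qform E ls f f * qform E ls g g.
  move=> ppg; rewrite /h expr2.
  have qE g' : pp F 1 g' ->
      qform E ls g g' = \sum_i ray_values F g 0 i * qform E ls (x_ F i) g'.
    move=> ppg'; exact: (functional_ray_values simpF posE ppg (ppSM ppg' (pp_prod ppls))).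
  congr (_ * _ - _ * _); first by rewrite qformC qE.
    by rewrite qformC qE.
  rewrite qE //; apply: eq_bigr => j _; congr (_ * _).
  by rewrite qformC qE //; apply: pp_coord.
rewrite -subr_ge0 -hE //; apply: closure_ge0 lK => [v|_ [g gK <-]].
  apply: continuous_mul_sub; try exact: continuous_coord_sum.
    exact: cst_continuous.
  apply: continuous_big => [|j _ w]; first exact: add_continuous.
  apply: (@cvgM R _ _ _ (fun v : 'rV[R]_m => v 0 j) (fun v : 'rV[R]_m => \sum_i v 0 i * b i j)).
  - exact: nbhs_filter.
  - exact: (@coord_continuous R 1 m 0 j w).
  - exact: continuous_coord_sum.
rewrite hE; last by case: gK.
by rewrite subr_ge0; exact: (lefschetz_lorentzian simpF lefF dimF posE gK lsK ppf).
Qed.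

Lemma lorentzian_closure l ls1 ls2 : fan_dim F = (size (ls1 ++ ls2)).+2 ->
  pos_functional F (size (ls1 ++ ls2)).+2 E -> in_closure_K F l ->
  List.Forall (in_closure_K F) ls1 -> List.Forall (in_K F) ls2 ->
  qform E (ls1 ++ ls2) f f * qform E (ls1 ++ ls2) l l <= qform E (ls1 ++ ls2) f l ^+ 2.
Proof.
move=> + + lK; elim: ls1 ls2 => [|l1 ls1 IH] ls2 dimF posE ls1K ls2K.
  exact: lorentzian_closure_fst.
have [[ppl1 l1K] {}ls1K] := (List.Forall_inv ls1K, List.Forall_inv_tail ls1K).
set ls := ls1 ++ ls2; have pplsE : List.Forall (pp F 1) ls.
  apply/List.Forall_app; split; last exact: Forall_in_K_pp.
  by apply: List.Forall_impl ls1K => g [].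
have ppl := proj1 lK.
pose b g g' i := E (fun v => cone_coord F v 0 i * (g v * (g' v * \prod_(l <- ls) l v))).
have qE g0 g g' : pp F 1 g0 -> pp F 1 g -> pp F 1 g' ->
    qform E (g0 :: ls) g g' = \sum_i ray_values F g0 0 i * b g g' i.
  move=> ppg0 ppg ppg'.
  rewrite -(functional_ray_values simpF posE ppg0 (pp_qform pplsE ppg ppg')).
  by congr (E _); apply/funext => v; rewrite big_cons; ring.
pose h (v : 'rV[R]_m) := (\sum_i v 0 i * b f l i) * (\sum_i v 0 i * b f l i) -
  (\sum_i v 0 i * b f f i) * (\sum_i v 0 i * b l l i).
have hE g : pp F 1 g -> h (ray_values F g) = qform E (g :: ls) f l ^+ 2 -
    qform E (g :: ls) f f * qform E (g :: ls) l l.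
  by move=> ppg; rewrite !qE // expr2.
rewrite -subr_ge0 -hE //; apply: closure_ge0 l1K => [v|_ [g gK <-]].
  by apply: continuous_mul_sub; exact: continuous_coord_sum.
rewrite hE; last by case: gK.
have perm g1 g2 : qform E (g :: ls) g1 g2 = qform E (ls1 ++ g :: ls2) g1 g2.
  congr (E _); apply/funext => v; rewrite /ls !(big_cat, big_cons) /=; ring.
have sz : size (ls1 ++ g :: ls2) = size (l1 :: ls1 ++ ls2).
  by rewrite /= !size_cat /= addnS.
rewrite subr_ge0 !perm; apply: IH; rewrite ?sz //.
exact: List.Forall_cons.
Qed.

End Limit.
End Closure.

Theorem theorem5p28 (R : realType) (n m d : nat) (F : fan_data R n m)
  (w : {set 'I_m} -> R) (deg : ('rV[R]_n -> R) -> R)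
  (l : nat -> 'rV[R]_n -> R) :
  rational_simplicial_fan F -> lefschetz F ->
  fan_dim F = d -> (2 <= d)%N ->
  fundamental_weight F w -> degree_map F w deg ->
  piecewise_poly F 1 (l 1%N) ->
  (forall i, (2 <= i <= d)%N -> in_closure_K F (l i)) ->
  deg (fun x => \prod_(1 <= i < d.+1) l i x) ^+ 2 >=
  deg (fun x => l 1%N x * l 1%N x * \prod_(3 <= i < d.+1) l i x) *
  deg (fun x => l 2%N x * l 2%N x * \prod_(3 <= i < d.+1) l i x).
Proof.
move=> ratF lefF dimF d2 fw dm ppl1 lK.
have simpF := rational_simplicial ratF.
have posd := degree_pos_functional simpF fw dm.
pose ls := [seq l i | i <- index_iota 3 d.+1].
have lsd : d = (size ls).+2 by rewrite size_map size_iota subSS -[LHS](subnK d2) addn2.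
have lsK : List.Forall (in_closure_K F) ls.
  suff : forall r, all (fun i => (2 <= i <= d)%N) r ->
      List.Forall (in_closure_K F) [seq l i | i <- r].
    apply; apply/allP => i; rewrite mem_index_iota ltnS => /andP[i3 ->].
    by rewrite (ltnW i3).
  elim=> [|i r IHr] /=; first by move=> _; apply: List.Forall_nil.
  by move=> /andP[/lK iK /IHr rK]; apply: List.Forall_cons.
have qE i j : qform deg ls (l i) (l j) =
    deg (fun x => l i x * l j x * \prod_(3 <= i < d.+1) l i x).
  by congr (deg _); apply/funext => x; rewrite big_map mulrA.
have -> : (fun x => \prod_(1 <= i < d.+1) l i x) =
    (fun x => l 1%N x * l 2%N x * \prod_(3 <= i < d.+1) l i x).
  have d1 : (1 < d.+1)%N by rewrite ltnS ltnW.
  have d2' : (2 < d.+1)%N by rewrite ltnS.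
  by apply/funext => x; rewrite (big_ltn d1) (big_ltn d2') mulrA.
have := @lorentzian_closure _ _ _ F deg (l 1%N) simpF lefF ppl1 (l 2%N) ls [::].
rewrite cats0 !qE -lsd; apply=> //; first by rewrite -dimF.
by apply: lK; rewrite d2.
Qed.
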